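(* Let $n\ge d\ge 1$ and let $\xi_1,\dots,\xi_n$ be (possibly dependent) random vectors in $\mathbb{R}^d$ with partial sums $S_0=0$, $S_i=\xi_1+\dots+\xi_i$ for $1\le i\le n$, such that: (Ex) for every permutation $\sigma$ of $\{1,\dots,n\}$, the tuples $(\xi_{\sigma(1)},\dots,\xi_{\sigma(n)})$ and $(\xi_1,\dots,\xi_n)$ have the same distribution; (GP) for every $1\le i_1<\dots<i_d\le n$, the probability that the vectors $S_{i_1},\dots,S_{i_d}$ are linearly dependent is $0$. Let $C_n=\mathrm{Conv}(S_0,S_1,\dots,S_n)$ and let $f_k(C_n)$ be the number of $k$-dimensional faces of the polytope $C_n$. Then, for all $0\le k\le d-1$, $$\mathbb{E}[f_k(C_n)]=\frac{2\cdot k!}{n!}\sum_{l=0}^{\infty}\genfrac{[}{]}{0pt}{}{n+1}{d-2l}\genfrac{\{}{\}}{0pt}{}{d-2l}{k+1}.$$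
   Context: $\mathrm{Conv}$ denotes the convex hull. For $1\le m\le n$, $\genfrac{[}{]}{0pt}{}{n}{m}$ is the signless Stirling number of the first kind (the number of permutations of an $n$-element set with exactly $m$ cycles), and $\genfrac{\{}{\}}{0pt}{}{n}{m}$ is the Stirling number of the second kind (the number of partitions of an $n$-element set into $m$ non-empty subsets). By convention $\genfrac{[}{]}{0pt}{}{n}{m}=\genfrac{\{}{\}}{0pt}{}{n}{m}=0$ whenever $n\in\mathbb{N}=\{1,2,\dots\}$ and $m\in\mathbb{Z}\setminus\{1,\dots,n\}$, and also whenever $n\notin\mathbb{N}$; hence the sum has only finitely many non-zero terms. *)

(* Defs.v *)
From HB Require Import structures.
From mathcomp Require Import all_boot all_order all_algebra perm finmap.
From mathcomp Require Import all_classical all_reals all_analysis.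

Set Implicit Arguments.
Unset Strict Implicit.
Unset Printing Implicit Defensive.

Import Order.TTheory GRing.Theory Num.Theory.

Local Open Scope classical_set_scope.
Local Open Scope ring_scope.

(* Both Stirling numbers take integer arguments, so that they vanish (as by
   convention) at negative or otherwise out-of-range arguments. *)

Definition stirling1 (n m : int) : nat :=
  if 1 <= m <= n then #|[set s : 'S_(`|n|%N) | #|porbits s| == `|m|%N]|%SET
  else 0%N.

Definition stirling2 (n m : int) : nat :=
  if 1 <= m <= n then
    #|[set Q : {set {set 'I_(`|n|%N)}} |
        finset.partition Q [set: 'I_(`|n|%N)]%SET & #|Q| == `|m|%N]|%SET
  else 0%N.

Section ConvexGeometry.
Variables (R : realType) (d : nat).
Implicit Types (A C F : set 'rV[R]_d) (k : nat).

Definition convex_hull A : set 'rV[R]_d := smallest (@convex_set R 'rV[R]_d) A.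

Definition affine_set A : Prop :=
  forall x y (t : R), A x -> A y -> A ((1 - t) *: x + t *: y).

Definition affine_hull A : set 'rV[R]_d := smallest affine_set A.

(* The empty set has no dimension: its affine hull is empty. *)
Definition has_dim A k : Prop :=
  exists (x0 : 'rV[R]_d) (V : {vspace 'rV[R]_d}),
    affine_hull A = [set x | x - x0 \in V] /\ \dim V = k.

(* F is cut out by a valid inequality <u, x> <= c; thus the empty set and C
   itself are (improper) faces of C. *)
Definition is_face C F : Prop :=
  exists (u : 'rV[R]_d) (c : R),
    (forall x, C x -> \sum_(j < d) u 0 j * x 0 j <= c) /\
    F = C `&` [set x | \sum_(j < d) u 0 j * x 0 j = c].

(* [fset_set] is the empty set on infinite sets; a polytope C has finitely many
   faces, so this is the number of its k-dimensional faces. *)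
Definition face_number C k : nat :=
  #|` fset_set [set F | is_face C F /\ has_dim F k]|%fset.

End ConvexGeometry.

Section RandomWalk.
Context {R : realType} {dT : measure_display} {T : measurableType dT}.
Context {P : probability T R} {n d : nat}.

(* R^d is d.-tuple R as a measurable space and 'rV[R]_d as a vector space. *)
Definition row_of (x : d.-tuple R) : 'rV[R]_d := \row_j tnth x j.

Variable xi : 'I_n -> {RV P >-> d.-tuple R}.

(* The increments are indexed from 0, so [walk k] is the sum of the first k. *)
Definition walk (k : nat) (w : T) : 'rV[R]_d :=
  \sum_(i < n | (i < k)%N) row_of (xi i w).

Definition exchangeable : Prop :=
  forall (s : 'S_n) (A : set (n.-tuple (d.-tuple R))), measurable A ->
    pushforward P (fun w => [tuple xi (s i) w | i < n]) A =
    pushforward P (fun w => [tuple xi i w | i < n]) A.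

Definition general_position : Prop :=
  forall i : 'I_d -> nat,
    (forall j, (1 <= i j <= n)%N) ->
    (forall j1 j2 : 'I_d, (j1 < j2)%N -> (i j1 < i j2)%N) ->
    P [set w | ~~ free [tuple walk (i j) w | j < d]] = 0%E.

Definition walk_hull (w : T) : set 'rV[R]_d :=
  convex_hull [set walk k w | k in [set k | (k <= n)%N]].

End RandomWalk.

(* Main.v *)
(* Increments in general position satisfy a deterministic identity: the sum of
   f_k over the n! walks obtained by permuting them equals
   2 k! sum_l [n+1; d-2l] {d-2l; k+1}.  Exchangeability turns this sum into n!
   times the expectation.

   By general position, the k-faces of the hull of S_0, ..., S_n are the
   simplices spanned by the sets I of k+1 vertices carrying a supporting
   hyperplane.  By Gordan's alternative, I is not a face iff some linear
   dependence y of the increments, listed in the order of the walk and closed up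
   to the loop 0, y_1, ..., y_n, 0, strictly decreases at every step p outside I
   (the step crossing vertex p).  So one counts the pairs (permutation, I) "hit"
   by a generic subspace U of codimension d.  Deleting the last coordinate v of U
   relates this number to the same numbers for the projection of U (codimension
   d-1) and for the n subspaces {y_v = y_i} and {y_v = 0} (codimension d): on the
   convex set of y with a prescribed order of the other coordinates, the
   positions that v can take form an interval, so their number is one plus the
   number of coordinates that v can meet.  The resulting recursion is also
   satisfied by n! C(n+1,k+1) - 2 k! sum_l [n+1; d-2l] {d-2l; k+1}. *)
Require Import Defs.
From mathcomp Require Import all_boot all_order all_algebra perm.
From mathcomp Require Import zify ring lra.

Set Implicit Arguments.
Unset Strict Implicit.
Unset Printing Implicit Defensive.

(** * Stirling numbers *)

(** Counting non-faces moves the induction from walks to subspaces: whether a set is hit depends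
    only on the space of linear relations among the increments, and [generic] survives both
    projecting the last coordinate away and tying it to another coordinate or to 0. The recursion
    stops at codimension [n], where only the zero vector is left and only the full set is hit; there
    the claim says that the parity sum is half of a Lah number, which is the origin of the factor 2.
    The parity restriction persists because projection lowers [d] by one just as the Stirling
    recurrences lower the summation index, while the ties keep [d] and supply the integer factor of
    the recurrence of the first kind. On the probabilistic side, being a face is an uncountable
    existential, so its event is replaced by a measurable one that agrees with it in general
    position; and general position is assumed for the given order only, so exchangeability must also
    carry it over to all permuted walks. *)

Fixpoint stir1 (n m : nat) : nat :=
  match n, m with
  | 0, 0 => 1
  | n'.+1, m'.+1 => stir1 n' m' + n' * stir1 n' m
  | _, _ => 0
  end.

Fixpoint stir2 (n m : nat) : nat :=
  match n, m with
  | 0, 0 => 1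
  | n'.+1, m'.+1 => stir2 n' m' + m * stir2 n' m
  | _, _ => 0
  end.

Lemma stir2_gt n m : n < m -> stir2 n m = 0.
Proof.
elim: n m => [|n IH] [|m] //= nm.
by rewrite !IH ?muln0 // ltnW.
Qed.

Lemma stir1_gt n m : n < m -> stir1 n m = 0.
Proof.
elim: n m => [|n IH] [|m] //= nm.
by rewrite !IH ?muln0 // ltnW.
Qed.

Section PorbitsLift.
Variable n : nat.
Implicit Type s : 'S_n.
Let L s := lift_perm ord_max ord_max s.

Lemma lift_permX s (i : nat) x :
  (L s ^+ i)%g (lift ord_max x) = lift ord_max ((s ^+ i)%g x).
Proof.
by elim: i => [|i IH]; rewrite ?expg0 ?perm1 // !expgSr !permM IH lift_perm_lift.
Qed.

Lemma porbit_lift_perm s x :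
  porbit (L s) (lift ord_max x) = lift ord_max @: porbit s x.
Proof.
apply/setP => y; apply/porbitP/imsetP.
  by case=> i ->; exists ((s ^+ i)%g x); rewrite ?lift_permX // mem_porbit.
by case=> z /porbitP[i ->] ->; exists i; rewrite lift_permX.
Qed.

Lemma porbit_lift_perm_max s : porbit (L s) ord_max = [set ord_max].
Proof.
apply/setP => y; rewrite inE; apply/porbitP/eqP => [[i ->]|->]; last first.
  by exists 0; rewrite expg0 perm1.
elim: i => [|i IH]; first by rewrite expg0 perm1.
by rewrite expgSr permM IH /L lift_perm_id.
Qed.

Lemma card_porbits_lift_perm s : #|porbits (L s)| = #|porbits s|.+1.
Proof.
have -> : porbits (L s) =
    [set ord_max] |: [set lift ord_max @: (B : {set 'I_n}) | B in porbits s].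
  apply/setP => B; rewrite !inE; apply/imsetP/orP.
    case=> y _ ->; case: (unliftP ord_max y) => [x|] ->.
      by right; rewrite porbit_lift_perm; apply/imset_f/imset_f.
    by left; rewrite porbit_lift_perm_max.
  case=> [/eqP->|/imsetP[C /imsetP[x _ ->] ->]].
    by exists ord_max => //; rewrite porbit_lift_perm_max.
  by exists (lift ord_max x) => //; rewrite porbit_lift_perm.
rewrite cardsU1 card_imset; last exact/imset_inj/lift_inj.
rewrite (_ : _ \notin _ = true) //.
apply/imsetP => -[B _ /setP/(_ ord_max)]; rewrite inE eqxx => /esym/imsetP[x _].
by move/eqP; rewrite (negPf (neq_lift _ _)).
Qed.

End PorbitsLift.

Lemma lift_perm_inj n (i j : 'I_n.+1) : injective (lift_perm i j).
Proof.
move=> s t /permP e; apply/permP => x; have := e (lift i x).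
by rewrite !lift_perm_lift => /lift_inj.
Qed.

Lemma sum_perm_bij (n : nat) (g : 'I_n.+1 * 'S_n -> 'S_n.+1) (F : 'S_n.+1 -> nat) :
  injective g ->
  \sum_(s : 'S_n.+1) F s = \sum_(s : 'S_n) \sum_(j : 'I_n.+1) F (g (j, s)).
Proof.
move=> gi; have gb : bijective g.
  apply: inj_card_bij gi _.
  by rewrite card_prod !card_Sn card_ord factS.
rewrite (reindex g) /=; last exact/onW_bij.
by rewrite exchange_big pair_big /=; apply: eq_bigr => -[].
Qed.

(** Read as a word of labels, [lift_perm j ord_max s] is the word [s] with the largest letter
    inserted at position [j]. *)
Lemma sum_perm_insert (n : nat) (F : 'S_n.+1 -> nat) :
  \sum_(s : 'S_n.+1) F s =
  \sum_(s : 'S_n) \sum_(j : 'I_n.+1) F (lift_perm j ord_max s).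
Proof.
apply: (@sum_perm_bij n (fun x => lift_perm x.1 ord_max x.2)) => -[i s] [j t] /= e.
have ij : i = j.
  by apply: (perm_inj (s := lift_perm i ord_max s)); rewrite lift_perm_id e lift_perm_id.
by move: e; rewrite ij => /lift_perm_inj ->.
Qed.

Lemma card_perm_cycles n m : #|[set s : 'S_n | #|porbits s| == m]| = stir1 n m.
Proof.
have E k : #|[set s : 'S_k | #|porbits s| == m]| = \sum_(s : 'S_k) (#|porbits s| == m).
  by rewrite -sum1dep_card [RHS]big_mkcond [LHS]big_mkcond; apply: eq_bigr => s _; case: eqP.
rewrite E {E}; elim: n m => [|n IH] m.
  rewrite (eq_bigr (fun _ => (m == 0) : nat)) => [|s _].
    by rewrite sum_nat_const card_Sn mul1n; case: m.
  suff -> : porbits s = set0 by rewrite cards0 eq_sym.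
  by apply/setP => B; rewrite inE; apply/imsetP => -[[]].
(* The product sends [j] to [ord_max] and [ord_max] to the old image of [j]: it inserts [ord_max]
   after [j] in the cycle of [j], or, for [j = ord_max], leaves it as a new cycle. *)
rewrite (@sum_perm_bij n (fun x => tperm ord_max x.1 * lift_perm ord_max ord_max x.2)%g);
  last first.
  move=> [i s] [j t] /= e.
  have lp (a : 'I_n.+1) (u : 'S_n) :
      (tperm ord_max a * lift_perm ord_max ord_max u)%g a = ord_max.
    by rewrite permM tpermR lift_perm_id.
  have ij : i = j.
    by apply: (perm_inj (s := (tperm ord_max i * lift_perm ord_max ord_max s)%g));
       rewrite lp e lp.
  by move: e; rewrite ij => /mulgI/lift_perm_inj ->.
have card_mul (s : 'S_n) (j : 'I_n.+1) :
    #|porbits (tperm ord_max j * lift_perm ord_max ord_max s)%g| =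
    #|porbits s| + (j == ord_max).
  have [->|jm] := eqVneq j ord_max.
    by rewrite tperm1 mul1g card_porbits_lift_perm addn1.
  have := porbits_mul_tperm (lift_perm ord_max ord_max s) ord_max j.
  case: (unliftP ord_max j) jm => [x ->|-> /eqP//] jm.
  rewrite porbit_lift_perm card_porbits_lift_perm eq_sym jm.
  have -> : (ord_max \notin [set lift ord_max y | y in porbit s x]).
    by apply/imsetP => -[y _ /eqP]; rewrite (negPf (neq_lift _ _)).
  by move=> /=; lia.
under eq_bigr => s _ do under eq_bigr => j _ do rewrite card_mul.
under eq_bigr => s _ do rewrite big_ord_recr /= eqxx addn1.
rewrite big_split /= addnC; case: m => [|m] /=.
  rewrite big1 ?add0n //; apply: big1 => s _; apply: big1 => j _.
  rewrite /= -val_eqE /= (ltn_eqF (ltn_ord _)) addn0.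
  suff : porbits s != set0 by rewrite -cards_eq0 => /negPf->.
  apply/set0Pn; exists (porbit s j); exact: imset_f.
rewrite -!IH; congr (_ + _).
rewrite big_distrr /=; apply: eq_bigr => s _.
rewrite (eq_bigr (fun _ => (#|porbits s| == m.+1) : nat)) ?sum_nat_const ?card_ord // => j _.
by rewrite -val_eqE /= (ltn_eqF (ltn_ord _)) addn0.
Qed.

(** * Counting set partitions *)

Section Partitions.
Variable T : finType.
Implicit Types (A B C : {set T}) (Q : {set {set T}}) (x : T).

Definition partitions_of A (m : nat) := [set Q | finset.partition Q A & #|Q| == m].

Definition grow_block x (QB : {set {set T}} * {set T}) : {set {set T}} :=
  (x |: QB.2) |: (QB.1 :\ QB.2).

Definition shrink_block x Q : {set {set T}} * {set T} :=
  let B := pblock Q x in ((B :\ x) |: (Q :\ B), B :\ x).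

Lemma notin_block x A Q B : x \notin A -> finset.partition Q A -> B \in Q -> x \notin B.
Proof. by move=> xA pQ BQ; apply: contra xA; apply/subsetP; apply: partitionS pQ BQ. Qed.

Lemma grow_blockP x A Q B : x \notin A -> finset.partition Q A -> B \in Q ->
  [/\ finset.partition (grow_block x (Q, B)) (x |: A), #|grow_block x (Q, B)| = #|Q|,
      [set x] \notin grow_block x (Q, B) & shrink_block x (grow_block x (Q, B)) = (Q, B)].
Proof.
move=> xA pQ BQ; have xB := notin_block xA pQ BQ.
have pD : finset.partition (grow_block x (Q, B)) (x |: A).
  have -> : x |: A = (x |: B) :|: (A :\: B).
    rewrite -finset.setUA; congr (_ :|: _).
    by rewrite finset.setDE finset.setUIr finset.setUCr finset.setIT;
      apply/esym/setUidPr/(partitionS pQ).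
  apply: partitionU1; first exact: partitionD1.
    by apply/set0Pn; exists x; rewrite setU11.
  rewrite disjoints_subset; apply/subsetP => y; rewrite !inE.
  by case/predU1P => [->|->]//; rewrite negb_and xA orbT.
have xBQ : x |: B \notin Q :\ B.
  rewrite !inE negb_and; apply/orP; right; apply: contra xA => h.
  by apply: (subsetP (partitionS pQ h)); rewrite setU11.
have pb : pblock (grow_block x (Q, B)) x = x |: B.
  by apply: def_pblock; rewrite ?(partition_trivIset pD) ?setU11.
split=> //.
- by rewrite cardsU1 xBQ (cardsD1 B Q) BQ.
- rewrite !inE negb_or negb_and negbK; apply/andP; split.
    have /set0Pn[y yB] := partition_neq0 pQ BQ.
    apply/eqP => /setP/(_ y); rewrite !inE yB orbT => /eqP yx.
    by rewrite -yx yB in xB.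
  apply/orP; right; apply: contra xA => h.
  by apply: (subsetP (partitionS pQ h)); rewrite set11.
- by rewrite /shrink_block pb /grow_block /= setU1K // setU1K // setD1K.
Qed.

Lemma shrink_blockP x A Q : x \notin A -> finset.partition Q (x |: A) -> [set x] \notin Q ->
  let RB := shrink_block x Q in
  [/\ finset.partition RB.1 A, #|RB.1| = #|Q|, RB.2 \in RB.1 & grow_block x RB = Q].
Proof.
move=> xA pQ xQ RB; set B := pblock Q x.
have xc : x \in cover Q by rewrite (cover_partition pQ) setU11.
have BQ : B \in Q by apply: pblock_mem.
have xB : x \in B by rewrite mem_pblock.
have B0 : B :\ x != set0.
  apply: contra xQ => /eqP B0.
  suff <- : B = [set x] by [].
  by rewrite -(setD1K xB) B0 finset.setU0.
have BA : B :\ x \subset A.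
  by rewrite subDset; apply: partitionS pQ BQ.
have BnQ : B :\ x \notin Q :\ B.
  rewrite !inE negb_and; apply/orP; right; apply/negP => h.
  have /set0Pn[y yB] := B0.
  have : B :\ x = B.
    rewrite -(def_pblock (partition_trivIset pQ) h yB).
    apply: def_pblock => //; first exact: partition_trivIset pQ.
    by move: yB; rewrite inE => /andP[].
  by move/setP/(_ x); rewrite !inE eqxx xB.
have pR : finset.partition RB.1 A.
  have -> : A = (B :\ x) :|: (A :\: (B :\ x)).
    by rewrite -[LHS](setID A (B :\ x)) (setIidPr BA).
  have pQB : finset.partition (Q :\ B) (A :\: (B :\ x)).
    have -> : A :\: (B :\ x) = (x |: A) :\: B.
      apply/setP => y; rewrite !inE; have [->|] := eqVneq y x => //=.
      by rewrite xB (negPf xA).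
    exact: partitionD1.
  apply: partitionU1 => //.
  by rewrite disjoints_subset; apply/subsetP => y yB; rewrite finset.in_setC finset.in_setD yB.
split=> //.
- by rewrite cardsU1 BnQ (cardsD1 B Q) BQ.
- by rewrite /RB /= setU11.
- by rewrite /grow_block /RB /= setU1K // setD1K // setD1K.
Qed.

Lemma card_partitions A m : #|partitions_of A m| = stir2 #|A| m.
Proof.
have [k] := ubnP #|A|; elim: k => // k IH in A m *; rewrite ltnS => Ak.
have [->|/set0Pn[x xA]] := eqVneq A set0.
  have -> : partitions_of set0 m = if m == 0 then [set set0] else set0.
    apply/setP => Q; rewrite inE partition_set0.
    have [->|Q0] /= := eqVneq Q set0; last by case: ifP; rewrite !inE ?(negPf Q0).
    by rewrite cards0 eq_sym; case: ifP => m0; rewrite !inE ?eqxx.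
  by rewrite cards0; case: m => [|m] /=; rewrite ?cards1 ?cards0.
have {xA} [B xB AB] : exists2 B : {set T}, x \notin B & A = x |: B.
  by exists (A :\ x); rewrite ?setD1K // !inE eqxx.
have cA : #|A| = #|B|.+1 by rewrite AB cardsU1 xB.
rewrite cA in Ak *; rewrite AB {A AB cA}; case: m => [|m].
  apply: eq_card0 => Q; rewrite inE cards_eq0; apply/negP => /andP[pQ /eqP Q0].
  have := cover_partition pQ; rewrite Q0 /cover big_set0 => /setP/(_ x).
  by rewrite setU11 inE.
(* Either [[set x]] is a block of its own, or [x] was added to one of the [m.+1] blocks of a
   partition of [B]: the two terms of the recurrence. *)
have -> : partitions_of (x |: B) m.+1 =
    [set [set x] |: Q | Q : {set {set T}} in partitions_of B m] :|:
    grow_block x @: [set QB | (QB.1 \in partitions_of B m.+1) && (QB.2 \in QB.1)].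
  apply/setP => Q; apply/idP/setUP => [|[]/imsetP[]].
  - rewrite inE => /andP[pQ cQ].
    have [xQ|xQ] := boolP ([set x] \in Q).
      left; apply/imsetP; exists (Q :\ [set x]); last by rewrite setD1K.
      move: cQ; rewrite (cardsD1 [set x]) xQ add1n eqSS !inE => ->; rewrite andbT.
      by have := partitionD1 pQ xQ; rewrite setU1K.
    right; have [p c i e] := shrink_blockP xB pQ xQ.
    by apply/imsetP; exists (shrink_block x Q); rewrite // inE i andbT inE p c.
  - move=> R; rewrite inE => /andP[pR cR] ->.
    have xR : [set x] \notin R.
      by apply/negP => /(notin_block xB pR); rewrite set11.
    rewrite inE cardsU1 xR (eqP cR) eqxx andbT; apply: partitionU1 => //.
      by apply/set0Pn; exists x; rewrite set11.
    by rewrite disjoints_subset sub1set inE.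
  - move=> [R C]; rewrite !inE => /andP[/andP[/= pR cR] CR] ->.
    by have [-> -> _ _] := grow_blockP xB pR CR.
set X := [set _ | _ in _]; set Y := grow_block x @: _.
have XY0 : X :&: Y = set0.
  apply/setP => Q; rewrite !inE; apply/negP => /andP[/imsetP[R _ ->] /imsetP[[S C]]].
  rewrite !inE => /andP[/andP[/= pS _] CS] e.
  by have [_ _ ] := grow_blockP xB pS CS; rewrite -e setU11.
rewrite cardsU XY0 cards0 subn0 card_in_imset; last first.
  move=> Q R; rewrite !inE => /andP[pQ _] /andP[pR _] e.
  have xN S : finset.partition S B -> [set x] \notin S.
    by move=> pS; apply/negP => /(notin_block xB pS); rewrite set11.
  by rewrite -(setU1K (xN _ pQ)) e setU1K // xN.
rewrite card_in_imset; last first.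
  move=> [Q C] [R D]; rewrite !inE /= => /andP[/andP[/= pQ _] CQ] /andP[/andP[/= pR _] DR] e.
  have [_ _ _ <-] := grow_blockP xB pQ CQ.
  by have [_ _ _ <-] := grow_blockP xB pR DR; rewrite e.
rewrite /= -!IH // -!/(partitions_of _ _); congr (_ + _).
rewrite -sum1dep_card (eq_bigl (fun QB => (QB.1 \in partitions_of B m.+1) && (QB.2 \in QB.1))) //.
rewrite -(pair_big_dep (fun Q => Q \in partitions_of B m.+1) (fun Q C => C \in Q) (fun _ _ => 1)) /=.
rewrite [LHS](eq_bigr (fun _ => m.+1)) => [|Q].
  by rewrite sum_nat_const mulnC.
by rewrite inE sum1_card => /andP[_ /eqP].
Qed.

End Partitions.

(** * Stirling sums of fixed parity *)

Definition parity_sum (n k d : nat) : nat :=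
  \sum_(j < d.+1 | odd j == odd d) stir1 n j * stir2 j k.

Lemma parity_sum00 n k : parity_sum n k.+1 0 = 0.
Proof. by rewrite /parity_sum big_mkcond big_ord1 /= muln0. Qed.

(** The recurrence of the first kind splits off the term with factor [n]; only the remaining part is
    expanded by the recurrence of the second kind, where [j] and [d] drop together and their
    parities stay matched. *)
Lemma parity_sum_rec n k d :
  parity_sum n.+1 k.+1 d.+1 = parity_sum n k d + k.+1 * parity_sum n k.+1 d
                              + n * parity_sum n k.+1 d.+1.
Proof.
rewrite /parity_sum big_mkcond big_ord_recl /= mul0n if_same add0n -big_mkcond /=.
rewrite (eq_bigl (fun j : 'I_d.+1 => odd j == odd d)); last first.
  by move=> j; rewrite /= (inj_eq negb_inj).
under eq_bigr do rewrite mulnDl mulnDr.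
rewrite !big_split /= big_distrr /=; congr (_ + _ + _).
  by apply: eq_bigr => j _; rewrite mulnCA.
rewrite [in RHS]big_mkcond [in RHS]big_ord_recl /= muln0 if_same add0n -[in RHS]big_mkcond /=.
rewrite [in RHS](eq_bigl (fun j : 'I_d.+1 => odd j == odd d)); last first.
  by move=> j; rewrite /= (inj_eq negb_inj).
by rewrite big_distrr /=; apply: eq_bigr => j _; rewrite mulnA.
Qed.

Lemma parity_sum_n0 n d : parity_sum n.+1 0 d = 0.
Proof. by apply: big1 => -[[|j] ?] _; rewrite ?muln0. Qed.

Lemma parity_sum_gt n k d : d < k -> parity_sum n k d = 0.
Proof.
move=> dk; apply: big1 => j _; rewrite stir2_gt ?muln0 //.
by apply: leq_ltn_trans dk; rewrite -ltnS.
Qed.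

Lemma stir1_diag n : stir1 n n = 1.
Proof. by elim: n => //= n ->; rewrite stir1_gt // muln0. Qed.

Lemma stir2_diag n : stir2 n n = 1.
Proof. by elim: n => //= n ->; rewrite stir2_gt // muln0. Qed.

Lemma parity_sum_diag n d : n <= d.+1 -> parity_sum n n d = (odd n == odd d).
Proof.
rewrite leq_eqVlt ltnS => /predU1P[->|nd].
  by rewrite parity_sum_gt //=; case: (odd d).
rewrite /parity_sum big_mkcond (bigD1 (inord n : 'I_d.+1)) //= inordK ?ltnS //.
rewrite stir1_diag stir2_diag big1 ?addn0; first by case: ifP.
move=> j jn; case: ifP => // _; have [jn'|nj|e] := ltngtP j n.
- by rewrite stir2_gt ?muln0.
- by rewrite stir1_gt.
- by case/eqP: jn; apply: val_inj; rewrite /= inordK ?ltnS.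
Qed.

(** This is the recursion of [count_hits_rec] for the number of all pairs of a permutation and a
    set: [k + n.+2] is [k.+1] from the projection plus one for each of the [n.+1] ties. *)
Lemma fact_bin_rec n k :
  n.+1`! * 'C(n.+2, k.+1) =
  k * (n`! * 'C(n.+1, k)) + (k + n.+2) * (n`! * 'C(n.+1, k.+1)).
Proof.
have := mul_bin_left n.+1 k; rewrite factS (binS n.+1).
have [kn|kn] := leqP k n.+1; last by rewrite !bin_small ?muln0 //; lia.
have := subnKC kn; move: (n.+1 - k) 'C(n.+1, k.+1) 'C(n.+1, k) n`! => m b a f mE e.
have -> : n.+1 * f * (b + a) = (m * a + k * a + n.+1 * b) * f by rewrite -mE; lia.
rewrite -e; lia.
Qed.

(* Both parities contribute equally: the alternating sum
   [sum_j (-1)^j [n j] {j k}] vanishes for [k < n]. *)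
Lemma parity_sum_lah n k d : k < n -> n <= d ->
  2 * k`! * parity_sum n.+1 k.+1 d = n`! * 'C(n.+1, k.+1).
Proof.
elim: n k d => // n IH k [//|d]; rewrite !ltnS => kn nd.
rewrite parity_sum_rec fact_bin_rec -addnA mulnDr.
have -> : 2 * k`! * parity_sum n.+1 k d = k * (n`! * 'C(n.+1, k)).
  case: k kn => [|k] kn; first by rewrite parity_sum_n0 muln0.
  by rewrite -(IH _ d) // factS; lia.
congr (_ + _); have [e|kn'] := eqVneq k n.
  rewrite e binn !parity_sum_diag //=; last by rewrite ltnS (leq_trans nd).
  by case: (odd n); case: (odd d) => /=; lia.
have {kn'} kn' : k < n by rewrite ltn_neqAle kn'.
rewrite mulnDr !(mulnCA (2 * k`!)) IH // IH ?(leq_trans nd) // -mulnDl; lia.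
Qed.

From mathcomp Require Import boolp.

Import Order.TTheory GRing.Theory Num.Theory.

(** * Orderings hit by a generic subspace *)

Section Loop.
Local Open Scope ring_scope.
Variable R : realFieldType.

(** The default 0 closes the loop: [loop y s n.+1] is 0, the same value as at position 0. *)
Definition ord_val n (f : 'I_n -> R) (q : nat) : R :=
  if insub q is Some i then f i else 0.

Definition loop n (y : 'I_n -> R) (s : 'S_n) (p : nat) : R :=
  if p is q.+1 then ord_val (fun i => y (s i)) q else 0.

Lemma ord_valE n (f : 'I_n -> R) (i : 'I_n) : ord_val f i = f i.
Proof. by rewrite /ord_val valK. Qed.

Lemma ord_val_out n (f : 'I_n -> R) q : (n <= q)%N -> ord_val f q = 0.
Proof. by move=> nq; rewrite /ord_val insubN // -leqNgt. Qed.

Lemma loop_lin n (a : R) (y1 y2 : 'I_n -> R) s p :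
  loop (fun i => a * y1 i + y2 i) s p = a * loop y1 s p + loop y2 s p.
Proof.
case: p => [|q] /=; first by rewrite mulr0 addr0.
by rewrite /ord_val; case: insub => // ; rewrite mulr0 addr0.
Qed.

Definition drop_last n (y : 'I_n.+1 -> R) (i : 'I_n) : R := y (lift ord_max i).

Lemma loop_insert n (y : 'I_n.+1 -> R) (s : 'S_n) (j : 'I_n.+1) (p : nat) :
  loop y (lift_perm j ord_max s) (bump j.+1 p) = loop (drop_last y) s p.
Proof.
case: p => [|q]; first by [].
rewrite bumpS /=; have [qn|nq] := ltnP q n; last first.
  by rewrite !ord_val_out // /bump; have := ltn_ord j; lia.
rewrite (_ : bump j q = lift j (Ordinal qn)) // ord_valE lift_perm_lift.
exact/esym/(ord_valE (fun i => drop_last y (s i)) (Ordinal qn)).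
Qed.

Lemma loop_insert_max n (y : 'I_n.+1 -> R) (s : 'S_n) (j : 'I_n.+1) :
  loop y (lift_perm j ord_max s) j.+1 = y ord_max.
Proof. by rewrite /= ord_valE lift_perm_id. Qed.

Definition descends n (y : 'I_n -> R) (s : 'S_n) (I : {set 'I_n.+1}) : Prop :=
  forall p : 'I_n.+1, p \notin I -> loop y s p.+1 < loop y s p.

(** The new value occupies loop position [j.+1] and splits the old step [j] into the steps numbered
    [j] (that is, [lift j1 j]) and [j.+1] (that is, [j1]); every other step is merely renumbered by
    [lift j1]. *)
Lemma descends_insert n (y : 'I_n.+1 -> R) (s : 'S_n) (j : 'I_n.+1) (I : {set 'I_n.+2}) :
  let j1 := lift ord0 j in
  descends y (lift_perm j ord_max s) I <->
  [/\ forall p : 'I_n.+1, p != j -> lift j1 p \notin I ->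
        loop (drop_last y) s p.+1 < loop (drop_last y) s p,
      lift j1 j \notin I -> y ord_max < loop (drop_last y) s j &
      j1 \notin I -> loop (drop_last y) s j.+1 < y ord_max].
Proof.
move=> j1; have j1E : j1 = j.+1 :> nat by [].
clearbody j1.
have bj : lift j1 j = j :> nat by rewrite /= /bump j1E ltnn.
have bj1 : bump j.+1 j.+1 = j.+2 by rewrite /bump leqnn.
set sj := lift_perm _ _ _.
have b1 p : lift j1 p = bump j.+1 p :> nat by rewrite /= j1E.
have E0 : loop y sj j = loop (drop_last y) s j by rewrite -(loop_insert y s j) /bump ltnn.
have E1 : loop y sj j.+1 = y ord_max by exact: loop_insert_max.
have E2 : loop y sj j.+2 = loop (drop_last y) s j.+1 by rewrite -(loop_insert y s j) bj1.
split=> [D|[D1 D2 D3] q].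
  split=> [p pj|/D|/D].
  - have e : (lift j1 p).+1 = bump j.+1 p.+1.
      rewrite /= /bump j1E; move: pj; rewrite -val_eqE /=; lia.
    by move=> /D; rewrite e b1 !(loop_insert y s j).
  - by rewrite bj E0 E1.
  - by rewrite j1E E1 E2.
case: (unliftP j1 q) => [p|] ->; last first.
  by move/D3; rewrite j1E E1 E2.
have [->|pj] := eqVneq p j.
  by move/D2; rewrite bj E0 E1.
have e : (lift j1 p).+1 = bump j.+1 p.+1.
  rewrite /= /bump j1E; move: pj; rewrite -val_eqE /=; lia.
by move/(D1 _ pj); rewrite e b1 !(loop_insert y s j).
Qed.

Definition subspace n (U : ('I_n -> R) -> Prop) : Prop :=
  U (fun=> 0) /\ forall a y1 y2, U y1 -> U y2 -> U (fun i => a * y1 i + y2 i).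

(* [U] is a subspace of codimension [min n d] in general position with respect to
   the braid arrangement of [0, y_1, .., y_n]; the label [ord0] marks the
   coordinates that are tied to the value 0. *)
Definition generic n d (U : ('I_n -> R) -> Prop) : Prop :=
  [/\ subspace U,
      forall (g : 'I_n -> 'I_d.+1) (c : 'I_d.+1 -> R), c ord0 = 0 ->
        U (fun i => c (g i)) -> forall i, c (g i) = 0 &
      forall (g : 'I_n -> 'I_d.+1), (forall j, j != ord0 -> exists i, g i = j) ->
        forall z : 'I_n -> R, exists c : 'I_d.+1 -> R,
          c ord0 = 0 /\ U (fun i => z i + c (g i))].

Definition hit n (U : ('I_n -> R) -> Prop) s I : bool :=
  `[< exists y, U y /\ descends y s I >].

Definition forget_last n (U : ('I_n.+1 -> R) -> Prop) : ('I_n -> R) -> Prop :=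
  fun y => exists2 x, U x & y = drop_last x.

Definition tie_last n (U : ('I_n.+1 -> R) -> Prop) (o : option 'I_n) :
    ('I_n -> R) -> Prop :=
  fun y => exists2 x, U x /\ x ord_max = oapp y 0 o & y = drop_last x.

Definition extend n (A : Type) (a : A) (f : 'I_n -> A) (i : 'I_n.+1) : A :=
  oapp f a (unlift ord_max i).

Lemma extend_max n (A : Type) (a : A) (f : 'I_n -> A) : extend a f ord_max = a.
Proof. by rewrite /extend unlift_none. Qed.

Lemma extend_lift n (A : Type) (a : A) (f : 'I_n -> A) i :
  extend a f (lift ord_max i) = f i.
Proof. by rewrite /extend liftK. Qed.

(** A labelling of the remaining coordinates extends to the last one by the label of its partner, or
    by [ord0] for a tie to 0, so both conditions on [tie_last U o] are instances of those on [U]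
    with the same labels. *)
Lemma tie_last_generic n d (U : ('I_n.+1 -> R) -> Prop) o :
  generic d U -> generic d (tie_last U o).
Proof.
move=> [[U0 UL] UK US]; split.
- split; first by exists (fun=> 0) => //; split => //; case: o.
  move=> a y1 y2 [x1 [Ux1 e1] ey1] [x2 [Ux2 e2] ey2].
  exists (fun i => a * x1 i + x2 i); last by rewrite ey1 ey2.
  split; first exact: UL.
  by rewrite e1 e2; case: (o) => //=; rewrite mulr0 addr0.
- move=> g c c0 [x [Ux xm] e] i.
  have := UK (extend (oapp g ord0 o) g) c c0.
  have -> : (fun i => c (extend (oapp g ord0 o) g i)) = x.
    apply: funext => k; case: (unliftP ord_max k) => [k'|] ->.
      by rewrite extend_lift; have /(congr1 (@^~ k')) := e.
    by rewrite extend_max xm; case: (o).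
  move=> /(_ Ux) h; have /(congr1 (@^~ i)) /= -> := e.
  by have := h (lift ord_max i); rewrite extend_lift => <-; have /(congr1 (@^~ i)) /= := e.
- move=> g gs z.
  have [|c [c0 Uc]] := US (extend (oapp g ord0 o) g) _ (extend (oapp z 0 o) z).
    by move=> j /gs[i <-]; exists (lift ord_max i); rewrite extend_lift.
  exists c; split=> //; eexists; first split; first exact: Uc.
    by rewrite /= !extend_max; case: (o) => //=; rewrite c0 addr0.
  by apply: funext => i; rewrite /drop_last !extend_lift.
Qed.

(** The unknown last coordinate receives a label of its own, [ord_max], and so uses up one of the
    [d] nonzero labels. For [d = 0] the subspace is the whole space, and so is its projection, in
    accordance with [0.-1 = 0]. *)
Lemma forget_last_generic n d (U : ('I_n.+1 -> R) -> Prop) :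
  generic d U -> generic d.-1 (forget_last U).
Proof.
move=> [[U0 UL] UK US]; split.
- split; first by exists (fun=> 0).
  move=> a _ _ [x1 Ux1 ->] [x2 Ux2 ->].
  by exists (fun i => a * x1 i + x2 i) => //; exact: UL.
- case: d UK US => [|d] UK US g c c0 [x Ux e] i; first by rewrite (ord1 (g i)).
  pose c' (k : 'I_d.+2) := oapp c (x ord_max) (unlift ord_max k).
  pose g' := extend ord_max (fun i => lift ord_max (g i)).
  have := UK g' c'; rewrite {1}/c' (_ : ord0 = lift ord_max ord0); last exact: val_inj.
  rewrite liftK /= => /(_ c0).
  have -> : (fun i => c' (g' i)) = x.
    apply: funext => k; case: (unliftP ord_max k) => [k'|] ->.
      by rewrite /g' extend_lift /c' liftK /=; have /(congr1 (@^~ k')) := e.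
    by rewrite /g' extend_max /c' unlift_none.
  by move=> /(_ Ux (lift ord_max i)); rewrite /g' extend_lift /c' liftK.
- case: d UK US => [|d] UK US g gs z.
    have [|c [c0 Uc]] := US (fun=> ord0) _ (extend 0 z).
      by move=> j; rewrite ord1.
    exists (fun=> 0); split=> //; eexists; first exact: Uc.
    by apply: funext => i; rewrite /drop_last extend_lift c0.
  have [|c [c0 Uc]] := US (extend ord_max (fun i => lift ord_max (g i))) _ (extend 0 z).
    move=> j j0; case: (unliftP ord_max j) j0 => [k|] -> k0; last first.
      by exists ord_max; rewrite extend_max.
    have /gs[i <-] : k != ord0 by apply: contra k0 => /eqP ->; apply/eqP/val_inj.
    by exists (lift ord_max i); rewrite extend_lift.
  exists (fun k => c (lift ord_max k)); split.
    by rewrite -[RHS]c0; congr c; apply: val_inj.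
  by eexists; [exact: Uc|apply: funext => i; rewrite /drop_last !extend_lift].
Qed.
End Loop.

(** * Positions of the last coordinate in a fixed order of the others *)

Section Local.
Local Open Scope ring_scope.
Variable R : realFieldType.

Lemma perturbation (T : finType) (D : pred T) (a b : T -> R) :
  (forall i, D i -> 0 < a i) ->
  exists2 e, 0 < e & forall i, D i -> 0 < a i + e * b i /\ 0 < a i - e * b i.
Proof.
(* [t] exceeds every ratio [|b i| / a i], and the summand 1 keeps it positive for empty [D]; its
   inverse is therefore small enough for both signs. *)
move=> a0; pose t := 1 + \sum_(i | D i) `|b i| / a i.
have s0 i : D i -> 0 <= `|b i| / a i by move=> Di; rewrite divr_ge0 // ltW // a0.
have t0 : 0 < t by rewrite ltr_wpDr // sumr_ge0.
exists t^-1; first by rewrite invr_gt0.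
move=> i Di; suff : `|t^-1 * b i| < a i by rewrite ltr_norml => /andP[h1 h2]; split; lra.
rewrite normrM normfV (gtr0_norm t0) mulrC ltr_pdivrMr // -ltr_pdivrMl ?a0 //.
rewrite mulrC /t (bigD1 i) //= addrCA ltr_pwDr // ?ltr_wpDr // ?ltr01 //.
by rewrite sumr_ge0 // => j /andP[Dj _]; exact: s0.
Qed.

(** Unless an endpoint already works, [t] is the parameter at which the two coordinates become
    equal; their sum is positive along the segment, hence so is the common value. *)
Lemma segment_pos (a1 b1 a2 b2 : R) :
  0 < a1 + b1 -> 0 < a2 + b2 -> 0 < a1 -> 0 < b2 ->
  exists t, [/\ 0 <= t, t <= 1, 0 < (1 - t) * a1 + t * a2 & 0 < (1 - t) * b1 + t * b2].
Proof.
move=> h1 h2 a10 b20; have [b10|b10] := ltP 0 b1.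
  by exists 0; rewrite !subr0 !mul1r !mul0r !addr0 lexx ler01.
have [a20|a20] := ltP 0 a2.
  by exists 1; rewrite !subrr !mul1r !mul0r !add0r lexx ler01.
have u0 : 0 < a1 - b1 by lra.
have v0 : 0 < b2 - a2 by lra.
have uv0 : 0 < (a1 - b1) + (b2 - a2) by rewrite addr_gt0.
have uv : (a1 - b1) + (b2 - a2) != 0 by rewrite gt_eqF.
set t := (a1 - b1) / ((a1 - b1) + (b2 - a2)).
have num : 0 < a1 * b2 - a2 * b1 by nra.
have ea : (1 - t) * a1 + t * a2 = (a1 * b2 - a2 * b1) / ((a1 - b1) + (b2 - a2)).
  by rewrite /t; field.
have eb : (1 - t) * b1 + t * b2 = (a1 * b2 - a2 * b1) / ((a1 - b1) + (b2 - a2)).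
  by rewrite /t; field.
exists t; rewrite ea eb divr_gt0 //; split=> //; first by rewrite divr_ge0 // ltW.
by rewrite ler_pdivrMr // mul1r lerDl ltW.
Qed.

Variables (n d : nat) (U : ('I_n.+1 -> R) -> Prop).
Hypotheses (gU : generic d U) (dn : (d <= n)%N).
Variables (s : 'S_n) (I : {set 'I_n.+1}).

Let z (y : 'I_n.+1 -> R) p : R := loop (drop_last y) s p.
Let P y := U y /\ descends (drop_last y) s I.
Let hit0 : bool := `[< exists y, P y >].
Let above p : bool := `[< exists y, P y /\ z y p < y ord_max >].
Let below p : bool := `[< exists y, P y /\ y ord_max < z y p >].
Let level p : bool := `[< exists y, P y /\ y ord_max = z y p >].
Let between p : bool := `[< exists y, P y /\ z y p.+1 < y ord_max < z y p >].

Let zlin a y1 y2 p : z (fun i => a * y1 i + y2 i) p = a * z y1 p + z y2 p.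
Proof. exact: loop_lin. Qed.

Let mix t (y1 y2 : 'I_n.+1 -> R) i := (1 - t) * y1 i + (t * y2 i + 0).

Let zmix t y1 y2 p : z (mix t y1 y2) p = (1 - t) * z y1 p + t * z y2 p.
Proof.
rewrite zlin (zlin t y2 (fun=> 0)); congr (_ + _).
suff -> : z (fun=> 0) p = 0 by rewrite addr0.
by rewrite /z /loop /ord_val; case: p => // q; case: insub.
Qed.

Let Pmix t y1 y2 : 0 <= t -> t <= 1 -> P y1 -> P y2 -> P (mix t y1 y2).
Proof.
have [[U0 UL] _ _] := gU => t0 t1 [U1 d1] [U2 d2]; split; first exact/UL/UL.
move=> p pI; have := d1 p pI; have := d2 p pI; rewrite -!/(z _ _) !zmix => h2 h1.
have [->|tn0] := eqVneq t 0; first lra.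
have tp : 0 < t by rewrite lt_def tn0.
have m2 : t * z y2 p.+1 < t * z y2 p by rewrite ltr_pM2l.
have m1 : (1 - t) * z y1 p.+1 <= (1 - t) * z y1 p by rewrite ler_wpM2l ?subr_ge0 // ltW.
lra.
Qed.

(** Give the last coordinate the same label as the coordinate visited at position [p], or [ord0] if
    [p = 0]. Correcting the unit vector of the last coordinate by label constants then leaves the
    difference equal to 1. Since [d <= n], the first [d] other coordinates suffice to carry all
    nonzero labels. *)
Lemma transversal_direction p : (p <= n)%N -> exists2 w, U w & w ord_max - z w p = 1.
Proof.
have [_ _ US] := gU => pn.
pose g0 (i : 'I_n) : 'I_d.+1 := if (i < d)%N then inord i.+1 else ord0.
pose o : option 'I_n := if p is q.+1 then omap s (insub q) else None.
have [|c [c0 Uc]] := US (extend (oapp g0 ord0 o) g0) _ (extend 1 (fun=> 0)).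
  move=> j j0; have jd : (j.-1 < d)%N.
    by have := ltn_ord j; move: j0; rewrite -val_eqE /=; case: (j : nat).
  exists (lift ord_max (Ordinal (leq_trans jd dn))).
  by rewrite extend_lift /g0 /= jd prednK ?lt0n // inord_val.
exists (fun i => extend 1 (fun=> 0) i + c (extend (oapp g0 ord0 o) g0 i)) => //.
rewrite !extend_max /o /z; case: p {o Uc} pn => [|q] pn /=; first by rewrite c0 addr0 subr0.
rewrite (insubT (fun q => (q < n)%N) pn) /=.
rewrite -[q in ord_val _ q]/(nat_of_ord (Ordinal pn)) ord_valE /drop_last !extend_lift.
by rewrite add0r addrK.
Qed.

Let hitP : reflect (exists y, P y) hit0. Proof. exact: asboolP. Qed.
Let aboveP p : reflect (exists y, P y /\ z y p < y ord_max) (above p).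
Proof. exact: asboolP. Qed.
Let belowP p : reflect (exists y, P y /\ y ord_max < z y p) (below p).
Proof. exact: asboolP. Qed.
Let levelP p : reflect (exists y, P y /\ y ord_max = z y p) (level p).
Proof. exact: asboolP. Qed.
Let betweenP p : reflect (exists y, P y /\ z y p.+1 < y ord_max < z y p) (between p).
Proof. exact: asboolP. Qed.

(** A small move along the transversal direction, in either sense, breaks the tie and keeps the
    finitely many strict descents. *)
Let level_above_below p : (p <= n)%N -> level p -> above p /\ below p.
Proof.
move=> pn /levelP[y [[Uy dy] yp]].
have [w Uw wp] := transversal_direction pn.
have [[_ UL] _ _] := gU.
have [|e e0 eP] := @perturbation 'I_n.+1 (fun q => q \notin I)
    (fun q => z y q - z y q.+1) (fun q => z w q - z w q.+1).
  by move=> q qI; rewrite subr_gt0; apply: dy.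
have ew a p' : z (fun i => a * w i + y i) p' = a * z w p' + z y p' by apply: zlin.
split.
  apply/aboveP; exists (fun i => e * w i + y i); split; last by rewrite ew; nra.
  split; first exact: UL.
  by move=> q qI; rewrite -!/(z _ _) !ew; have [h _] := eP q qI; lra.
apply/belowP; exists (fun i => - e * w i + y i); split; last by rewrite ew; nra.
split; first exact: UL.
by move=> q qI; rewrite -!/(z _ _) !ew; have [_ h] := eP q qI; lra.
Qed.

(** Inclusion-exclusion on the convex set [P]: [above p] and [below p] hold together exactly when
    [level p] holds, by perturbation in one direction and by a zero on a segment in the other, and
    if [P] is inhabited at least one of them holds. *)
Lemma level_add p : (p <= n)%N -> (level p + hit0 = above p + below p)%N.
Proof.
move=> pn; have LA := level_above_below pn.
have AH : above p -> hit0 by move=> /aboveP[y [Py _]]; apply/hitP; exists y.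
have BH : below p -> hit0 by move=> /belowP[y [Py _]]; apply/hitP; exists y.
have AB : above p -> below p -> level p.
  move=> /aboveP[y1 [P1 h1]] /belowP[y2 [P2 h2]]; apply/levelP.
  pose a := y1 ord_max - z y1 p; pose b := z y2 p - y2 ord_max.
  have a0 : 0 < a by rewrite subr_gt0.
  have b0 : 0 < b by rewrite subr_gt0.
  have ab0 : 0 < a + b by rewrite addr_gt0.
  (* The linear form [y ord_max - z y p] is [a] at [y1] and [- b] at [y2]; this weight is its
     zero. *)
  exists (mix (a / (a + b)) y1 y2); split.
    apply: Pmix => //; first by rewrite divr_ge0 ?ltW.
    by rewrite ler_pdivrMr // mul1r lerDl ltW.
  rewrite zmix /mix; apply/eqP; rewrite -subr_eq0; apply/eqP.
  transitivity (((a + b - a) / (a + b)) * a - (a / (a + b)) * b); last first.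
    by field; rewrite gt_eqF.
  have -> : (a + b - a) / (a + b) = 1 - a / (a + b) by field; rewrite gt_eqF.
  rewrite /a /b; ring.
have HL : hit0 -> [|| level p, above p | below p].
  move=> /hitP[y Py]; have [h|h|h] := ltgtP (z y p) (y ord_max).
  - by apply/or3P/Or32/aboveP; exists y.
  - by apply/or3P/Or33/belowP; exists y.
  - by apply/or3P/Or31/levelP; exists y.
by move: LA HL AB AH BH; case: (level p); case: (above p); case: (below p);
  case: hit0 => //= *; exfalso; intuition.
Qed.

(** Step [j] descends on [P], so each point satisfies one of the two bounds. Points satisfying one
    bound each are joined by a segment on which [segment_pos] finds a point satisfying both. *)
Lemma between_add (j : 'I_n.+1) : j \notin I ->
  (between j + hit0 = below j + above j.+1)%N.
Proof.
move=> jI.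
have AH : above j.+1 -> hit0 by move=> /aboveP[y [Py _]]; apply/hitP; exists y.
have BH : below j -> hit0 by move=> /belowP[y [Py _]]; apply/hitP; exists y.
have JAB : between j -> below j /\ above j.+1.
  move=> /betweenP[y [Py /andP[h1 h2]]].
  by split; [apply/belowP|apply/aboveP]; exists y.
have dj y : P y -> z y j.+1 < z y j by case=> _; apply.
have HAB : hit0 -> below j || above j.+1.
  move=> /hitP[y Py]; have [h|h] := ltP (y ord_max) (z y j).
    by apply/orP; left; apply/belowP; exists y.
  by apply/orP; right; apply/aboveP; exists y; split => //; apply: lt_le_trans h; apply: dj.
have ABJ : below j -> above j.+1 -> between j.
  move=> /belowP[y1 [P1 h1]] /aboveP[y2 [P2 h2]]; apply/betweenP.
  have [||||t [t0 t1 ht1 ht2]] := @segment_pos (z y1 j - y1 ord_max) (y1 ord_max - z y1 j.+1)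
    (z y2 j - y2 ord_max) (y2 ord_max - z y2 j.+1).
  - by have := dj _ P1; lra.
  - by have := dj _ P2; lra.
  - by lra.
  - by lra.
  exists (mix t y1 y2); split; first exact: Pmix.
  by rewrite !zmix /mix; apply/andP; split; lra.
by move: JAB HAB ABJ AH BH; case: (between j); case: (below j); case: (above j.+1);
  case: hit0 => //= *; exfalso; intuition.
Qed.

Let above_end : above n.+1 = above 0.
Proof.
have z0 y : z y n.+1 = 0 by rewrite /z /= ord_val_out.
by apply/aboveP/aboveP => -[y [Py h]]; exists y; move: h; rewrite z0.
Qed.

(** The steps in [I] cut the closed loop into [#|I|] descending chains. A chain of [m] vertices
    offers [m.+1] slots: below its end, above its start, or between neighbours; the slots that can
    be taken exceed the vertices that can be met by one. Algebraically, adding [hit0] for each [j]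
    outside [I] makes the left side a cyclic sum of [above] and [below], to which [level_add]
    applies vertex by vertex. *)
Lemma sum_insertions :
  (\sum_(j < n.+1) (if j \in I then above j.+1 + below j else between j)
   = #|I| * hit0 + \sum_(p < n.+1) level p)%N.
Proof.
apply/eqP; rewrite -(eqn_add2r (\sum_(j < n.+1) (j \notin I) * hit0)) -big_split /=.
rewrite (eq_bigr (fun j : 'I_n.+1 => below j + above j.+1)%N); last first.
  move=> j _; case: ifPn => jI /=; first by rewrite mul0n addn0 addnC.
  by rewrite mul1n between_add.
have cI : (\sum_(j < n.+1) (j \notin I) * hit0 + #|I| * hit0 = n.+1 * hit0)%N.
  rewrite -big_distrl -mulnDl -sum1_card [X in (_ + X)%N]big_mkcond -big_split /=; congr (_ * _)%N.
  rewrite (eq_bigr (fun=> 1%N)); first by rewrite sum1_card card_ord.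
  by move=> j _; case: (j \in I).
rewrite addnAC [X in _ == (X + _)%N]addnC cI -[X in (X * _)%N]card_ord -sum_nat_const -big_split /=.
under [X in _ == X]eq_bigr => p _ do rewrite addnC level_add -1?ltnS //.
rewrite !big_split /= [X in _ == X]addnC eqn_add2l.
(* The shift from [above j.+1] to [above j] is harmless because positions 0 and [n.+1] carry the
   same value 0. *)
by rewrite big_ord_recr /= above_end [X in _ == X]big_ord_recl /= addnC.
Qed.

End Local.

Lemma sum_set_lift (m : nat) (i : 'I_m.+1) (F : {set 'I_m.+1} -> nat) :
  \sum_(I : {set 'I_m.+1}) F I =
  \sum_(I : {set 'I_m}) (F (lift i @: I) + F (i |: lift i @: I)).
Proof.
have iN (I : {set 'I_m}) : i \notin lift i @: I.
  by apply/imsetP => -[x _ /eqP]; rewrite (negPf (neq_lift _ _)).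
have pre (I : {set 'I_m}) : lift i @^-1: (lift i @: I) = I.
  by apply/setP => x; rewrite inE mem_imset //; apply: lift_inj.
have im (I : {set 'I_m.+1}) : lift i @: (lift i @^-1: I) = I :\ i.
  apply/setP => y; rewrite !inE; case: (unliftP i y) => [x|] ->.
    by rewrite mem_imset ?inE 1?eq_sym ?neq_lift //; apply: lift_inj.
  by rewrite eqxx (negPf (iN _)).
rewrite (bigID [pred I : {set 'I_m.+1} | i \notin I]) /= big_split /=; congr (_ + _).
  rewrite (reindex_onto (fun I : {set 'I_m} => lift i @: I)
    (fun I : {set 'I_m.+1} => lift i @^-1: I)) /=.
    by apply: eq_bigl => I; rewrite iN pre eqxx.
  by move=> I iI; rewrite im; apply/setP => x; rewrite !inE;
    case: eqP => //= ->; rewrite (negPf iI).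
rewrite (reindex_onto (fun I : {set 'I_m} => i |: lift i @: I)
    (fun I : {set 'I_m.+1} => lift i @^-1: (I :\ i))) /=.
  apply: eq_bigl => I; rewrite setU11 /= finset.setDUl finset.setDv finset.set0U.
  rewrite (_ : (lift i @: I) :\ i = lift i @: I) ?pre ?eqxx //.
  by apply/setP => x; rewrite !inE; case: eqP => //= ->; rewrite (negPf (iN _)).
move=> I; rewrite negbK => iI; rewrite im -[RHS](setD1K iI); congr (_ |: _).
by apply/setP => x; rewrite !inE; case: eqP.
Qed.

Lemma sum_set_pair (T : finType) (j : T) (F : {set T} -> nat) :
  \sum_(I : {set T}) F I = \sum_(I : {set T} | j \in I) (F I + F (I :\ j)).
Proof.
rewrite (bigID [pred I : {set T} | j \in I]) /= big_split /=; congr (_ + _).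
rewrite (reindex_onto (fun I => I :\ j) (fun I => j |: I)) /=.
  apply: eq_bigl => I; rewrite !inE eqxx /=; apply/eqP/idP => [<-|/setD1K//].
  exact: setU11.
by move=> I jI; rewrite setU1K.
Qed.

(** * The recursion for the number of hits *)

Section Count.
Variable R : realFieldType.
Implicit Types n k : nat.

Definition count_hits n (U : ('I_n -> R) -> Prop) k : nat :=
  \sum_(s : 'S_n) \sum_(I : {set 'I_n.+1}) ((#|I| == k) && hit U s I).

Lemma hit_forget n (U : ('I_n.+1 -> R) -> Prop) s I :
  hit (forget_last U) s I =
  `[< exists y, U y /\ descends (drop_last y) s I >].
Proof.
apply/asboolP/asboolP => [[_ [[x Ux ->] dx]]|[x [Ux dx]]]; first by exists x.
by exists (drop_last x); split => //; exists x.
Qed.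

Lemma hit_tie n (U : ('I_n.+1 -> R) -> Prop) s I (o : option 'I_n) p :
  (forall y : 'I_n -> R, loop y s p = oapp y 0%R o) ->
  hit (tie_last U o) s I =
  `[< exists y, (U y /\ descends (drop_last y) s I) /\ y ord_max = loop (drop_last y) s p >].
Proof.
move=> E; apply/asboolP/asboolP => [[y [[x [Ux xm] ey] dx]]|[x [[Ux dx] xm]]].
  by subst y; exists x; rewrite E -xm.
by exists (drop_last x); split => //; exists x; rewrite // -E.
Qed.

Lemma hit_insert n (U : ('I_n.+1 -> R) -> Prop) (s : 'S_n) (j : 'I_n.+1) (I : {set 'I_n.+1}) :
  let j1 := lift ord0 j in let sj := lift_perm j ord_max s in
  let P y := U y /\ descends (drop_last y) s I in
  let z y := loop (drop_last y) s in
  hit U sj (lift j1 @: I) =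
    (if j \in I then `[< exists y, P y /\ (z y j.+1 < y ord_max)%R >]
     else `[< exists y, P y /\ (z y j.+1 < y ord_max < z y j)%R >]).
Proof.
move=> j1 sj P z.
have j1N : j1 \notin lift j1 @: I.
  by apply/imsetP => -[x _ /eqP]; rewrite (negPf (neq_lift _ _)).
have mI p : (lift j1 p \in lift j1 @: I) = (p \in I) by apply/mem_imset/lift_inj.
case: ifPn => jI; apply/asboolP/asboolP => -[y].
- case=> Uy /descends_insert[D1 D2 D3]; exists y; split; last exact: D3.
  split=> // p pI; apply: D1; rewrite ?mI //.
  by apply: contraNneq pI => ->.
- case=> -[Uy D] zy; exists y; split=> //; apply/descends_insert.
  by split=> [p pj||]; rewrite -/j1 ?mI //; [apply: D|rewrite jI].
- case=> Uy /descends_insert[D1 D2 D3].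
  have zj : (z y j.+1 < y ord_max < z y j)%R.
    by rewrite D3 // D2 // mI.
  exists y; split => //; split=> // p pI; have [->|pj] := eqVneq p j.
    by case/andP: zj; apply: lt_trans.
  by apply: D1; rewrite ?mI.
- case=> -[Uy D] /andP[zy1 zy2]; exists y; split=> //; apply/descends_insert.
  by split=> [p pj||]; rewrite -/j1 ?mI //; apply: D.
Qed.

(** With both halves of the split step in the set, the last coordinate is unconstrained and
    projection applies; with only the second half in it, the descent from position [j] remains.
    [hit_insert] covers the sets that miss the second half. *)
Lemma hit_insert_cut n (U : ('I_n.+1 -> R) -> Prop) (s : 'S_n) (j : 'I_n.+1)
    (I : {set 'I_n.+1}) : j \in I ->
  let j1 := lift ord0 j in let sj := lift_perm j ord_max s in
  let P y := U y /\ descends (drop_last y) s I in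
  hit U sj (j1 |: lift j1 @: I) = `[< exists y, P y >] /\
  hit U sj (j1 |: lift j1 @: (I :\ j)) =
    `[< exists y, P y /\ (y ord_max < loop (drop_last y) s j)%R >].
Proof.
move=> jI j1 sj P.
have mI p (J : {set 'I_n.+1}) : (lift j1 p \in j1 |: lift j1 @: J) = (p \in J).
  rewrite !inE eq_sym (negPf (neq_lift _ _)) /=; exact/mem_imset/lift_inj.
split; apply/asboolP/asboolP => -[y].
- case=> Uy /descends_insert[D1 D2 D3]; exists y.
  by split=> // p pI; apply: D1; rewrite ?mI //; apply: contraNneq pI => ->.
- case=> Uy D; exists y; split=> //; apply/descends_insert.
  by split=> [p pj||]; rewrite -/j1 ?mI ?jI ?setU11 //; apply: D.
- case=> Uy /descends_insert[D1 D2 D3]; exists y; split; last first.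
    by apply: D2; rewrite mI !inE eqxx.
  split=> // p pI; apply: D1; first by apply: contraNneq pI => ->.
  by rewrite mI !inE negb_and pI orbT.
- case=> -[Uy D] zy; exists y; split=> //; apply/descends_insert.
  split=> [p pj||//]; rewrite -/j1 ?mI ?setU11 //.
  by rewrite finset.in_setD1 pj; apply: D.
Qed.

Lemma count_hits_rec n d (U : ('I_n.+1 -> R) -> Prop) k :
  generic d U -> d <= n ->
  count_hits U k.+1 =
  k * count_hits (forget_last U) k + k.+1 * count_hits (forget_last U) k.+1
  + (count_hits (tie_last U None) k.+1
     + \sum_(i < n) count_hits (tie_last U (Some i)) k.+1).
Proof.
move=> gU dn; rewrite {1}/count_hits sum_perm_insert.
have step (s : 'S_n) (j : 'I_n.+1) (J := lift_perm j ord_max s) :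
  \sum_(I : {set 'I_n.+2}) ((#|I| == k.+1) && hit U J I) =
  \sum_(I : {set 'I_n.+1})
   ((j \in I) * ((#|I| == k) && hit (forget_last U) s I) +
   (#|I| == k.+1) * (if j \in I then
     `[< exists y, (U y /\ descends (drop_last y) s I) /\ (loop (drop_last y) s j.+1 < y ord_max)%R >] +
     `[< exists y, (U y /\ descends (drop_last y) s I) /\ (y ord_max < loop (drop_last y) s j)%R >]
    else
      `[< exists y, (U y /\ descends (drop_last y) s I) /\
            (loop (drop_last y) s j.+1 < y ord_max < loop (drop_last y) s j)%R >])).
  (* The four cases are whether each half of the split step [j] belongs to the new set. If both do,
     the new set has one element more than [I], hence the size [k]; in the other cases the size
     [k.+1] is kept, and [sum_set_pair] charges the case of the second half alone to a set [I]
     containing [j]. *)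
  set j1 := lift ord0 j.
  rewrite (sum_set_lift j1) big_split /= [X in _ + X](sum_set_pair j).
  rewrite [X in _ + X]big_mkcond -big_split /=; apply: eq_bigr => I _.
  have j1N (K : {set 'I_n.+1}) : j1 \notin lift j1 @: K.
    by apply/imsetP => -[x _ /eqP]; rewrite (negPf (neq_lift _ _)).
  rewrite hit_insert -!/(lift ord0 j) -/j1 card_imset; last exact: lift_inj.
  case: ifPn => jI; last by rewrite mul0n addn0 add0n mulnb.
  rewrite mul1n; have [-> ->] := hit_insert_cut U s jI.
  rewrite !cardsU1 !j1N !card_imset; try exact: lift_inj.
  rewrite hit_forget (cardsD1 j I) jI !add1n eqSS.
  by rewrite mulnDr !mulnb eqSS addnCA.
under eq_bigr => s _ do under eq_bigr => j _ do rewrite step.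
under eq_bigr => s _ do rewrite exchange_big /=.
have local (s : 'S_n) (I : {set 'I_n.+1}) :
  \sum_(j < n.+1)
   ((j \in I) * ((#|I| == k) && hit (forget_last U) s I) +
   (#|I| == k.+1) * (if j \in I then
     `[< exists y, (U y /\ descends (drop_last y) s I) /\ (loop (drop_last y) s j.+1 < y ord_max)%R >] +
     `[< exists y, (U y /\ descends (drop_last y) s I) /\ (y ord_max < loop (drop_last y) s j)%R >]
    else
      `[< exists y, (U y /\ descends (drop_last y) s I) /\
            (loop (drop_last y) s j.+1 < y ord_max < loop (drop_last y) s j)%R >])) =
  k * ((#|I| == k) && hit (forget_last U) s I) +
  k.+1 * ((#|I| == k.+1) && hit (forget_last U) s I) +
  (((#|I| == k.+1) && hit (tie_last U None) s I) +
    \sum_(i < n) ((#|I| == k.+1) && hit (tie_last U (Some (s i))) s I)).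
  rewrite big_split /= -big_distrl -big_distrr /=.
  rewrite (sum_insertions gU dn s I) -!hit_forget big_ord_recl /=.
  rewrite -(@hit_tie _ _ _ _ None 0) //.
  rewrite (eq_bigr (fun i : 'I_n => hit (tie_last U (Some (s i))) s I : nat)); last first.
    move=> i _; rewrite -(@hit_tie _ _ _ _ (Some (s i)) (bump 0 i)) // => y.
    by rewrite /= ord_valE.
  have -> : \sum_(j < n.+1) (j \in I) = #|I|.
    by rewrite -sum1_card [RHS]big_mkcond; apply: eq_bigr => j _; case: (j \in I).
  rewrite [X in _ + X = _]mulnDr [X in _ + (_ + X) = _]mulnDr -[RHS]addnA; congr (_ + (_ + (_ + _))).
  - by case: eqP => [->|_] //; rewrite !muln0.
  - rewrite mulnCA mulnb; case: eqP => [->|_] //; last by rewrite !muln0.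
  - by rewrite mulnb.
  - by rewrite big_distrr /=; apply: eq_bigr => i _; rewrite mulnb.
under eq_bigr => s _ do under eq_bigr => I _ do rewrite local.
under eq_bigr => s _ do rewrite !big_split -!big_distrr /= [X in _ + (_ + X)]exchange_big.
rewrite !big_split -!big_distrr /=; congr (_ + (_ + _)).
rewrite [LHS](eq_bigr (fun s => \sum_(i < n) \sum_(I : {set 'I_n.+1})
   ((#|I| == k.+1) && hit (tie_last U (Some i)) s I))).
  by rewrite exchange_big.
(* The local count ties the last coordinate to [s i], the one visited at position [i]; over all
   positions this runs through every coordinate once. *)
by move=> s _; rewrite [RHS](reindex_inj (@perm_inj _ s)).
Qed.
End Count.

(** * Solving the recursion *)

Section Total.
Variable R : realFieldType.

(** With [n] nonzero labels each coordinate can have its own, so every vector is constant on label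
    classes. *)
Lemma generic_full n (U : ('I_n -> R) -> Prop) y : generic n U -> U y -> y = fun=> 0%R.
Proof.
move=> [_ UK _] Uy; apply: funext => i.
have := UK (lift ord0) (fun k => oapp y 0%R (unlift ord0 k)).
rewrite unlift_none => /(_ erefl).
rewrite (_ : (fun i => _) = y); last by apply: funext => j; rewrite liftK.
by move=> /(_ Uy i); rewrite liftK.
Qed.

Lemma count_hits_full n (U : ('I_n -> R) -> Prop) k :
  generic n U -> count_hits U k.+1 = n`! * (k == n).
Proof.
move=> gU; rewrite -(card_Sn n) -sum_nat_const; apply: eq_bigr => s _.
have hitE I : hit U s I = (I == [set: 'I_n.+1]).
  apply/asboolP/eqP => [[y [/(generic_full gU) -> D]]|->].
    apply/setP => p; rewrite inE; apply/negPn/negP => /D.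
    have l0 q : loop (fun=> 0%R) s q = 0%R :> R.
      by case: q => // q; rewrite /= /ord_val; case: insub.
    by rewrite !l0 ltxx.
  by have [[U0 _] _ _] := gU; exists (fun=> 0%R); split => // p; rewrite inE.
rewrite (bigD1 [set: 'I_n.+1]) //= hitE eqxx andbT cardsT card_ord eqSS eq_sym.
by rewrite big1 ?addn0 // => I IT; rewrite hitE (negPf IT) andbF.
Qed.

Theorem count_hits_total n d (U : ('I_n -> R) -> Prop) k :
  generic d U -> d <= n ->
  count_hits U k.+1 + 2 * k`! * parity_sum n.+1 k.+1 d = n`! * 'C(n.+1, k.+1).
Proof.
elim: n d U k => [|n IH] d U k gU; rewrite leq_eqVlt ?ltn0 ?orbF.
  move/eqP=> d0; subst d; rewrite count_hits_full // parity_sum00 muln0 addn0.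
  by case: k.
rewrite ltnS => /predU1P[d0|dn].
  (* Full codimension: for [k < n.+1] nothing is hit and the whole total comes from
     [parity_sum_lah]; for [k = n.+1] the full set accounts for everything. *)
  subst d; rewrite count_hits_full //; have [kn|kn|->] := ltngtP k n.+1.
  - by rewrite muln0 parity_sum_lah.
  - by rewrite bin_small ?parity_sum_gt ?muln0 // ltnS ltnW.
  - by rewrite binn parity_sum_gt ?muln0 ?addn0.
rewrite (count_hits_rec _ gU dn) fact_bin_rec.
have gF := forget_last_generic gU; have dn1 : d.-1 <= n by rewrite (leq_trans (leq_pred _)).
have F1 := IH _ _ k gF dn1.
have F0 : k * count_hits (forget_last U) k + 2 * k`! * parity_sum n.+1 k d.-1 =
          k * (n`! * 'C(n.+1, k)).
  case: k {F1} => [|k]; first by rewrite parity_sum_n0 muln0.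
  by rewrite -(IH _ _ k gF dn1) mulnDr factS; lia.
have TN := IH _ _ k (tie_last_generic None gU) dn.
have TS : \sum_(i < n) count_hits (tie_last U (Some i)) k.+1
    + n * (2 * k`! * parity_sum n.+1 k.+1 d) = n * (n`! * 'C(n.+1, k.+1)).
  rewrite -[X in _ + X * (2 * _ * _)](card_ord n) -sum_nat_const -big_split /=.
  rewrite (eq_bigr (fun=> n`! * 'C(n.+1, k.+1))); first by rewrite sum_nat_const card_ord.
  by move=> i _; rewrite IH //; apply: tie_last_generic.
(* [parity_sum_rec] needs a successor; at [d = 0], where [d.-1] is 0 again, all the sums vanish. *)
have -> : parity_sum n.+2 k.+1 d = parity_sum n.+1 k d.-1 +
     k.+1 * parity_sum n.+1 k.+1 d.-1 + n.+1 * parity_sum n.+1 k.+1 d.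
  case: (d) => [|e]; last by rewrite parity_sum_rec.
  by rewrite !parity_sum00 !muln0; case: (k) => [|?]; rewrite ?parity_sum_n0 ?parity_sum00.
have {}F1 : k.+1 * count_hits (forget_last U) k.+1 +
    k.+1 * (2 * k`! * parity_sum n.+1 k.+1 d.-1) = k.+1 * (n`! * 'C(n.+1, k.+1)).
  by rewrite -mulnDr F1.
move: F0 F1 TN TS; move: (count_hits _ _) (count_hits _ _) (count_hits _ _) (\sum_(i < n) _).
move: (parity_sum _ _ _) (parity_sum _ _ _) (parity_sum _ _ _).
move: (n`! * _) (n`! * _) (2 * k`!) => *.
lia.
Qed.
End Total.

(** * Gordan duality and general position *)

Section Gordan.
Local Open Scope ring_scope.
Variable R : realFieldType.

Lemma row_sqr_gt0 N (v : 'rV[R]_N) : v != 0 -> 0 < (v *m v^T) 0 0.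
Proof.
move=> v0; rewrite mxE lt_def sumr_ge0 => [|i _]; last by rewrite mxE -expr2 sqr_ge0.
rewrite andbT psumr_eq0 => [|i _]; last by rewrite mxE -expr2 sqr_ge0.
apply: contra v0 => /allP h; apply/eqP/rowP => i; rewrite mxE.
have := h i (mem_index_enum _); rewrite mxE mulf_eq0 orbb => /eqP.
by rewrite [0](_ : _ = ord0) //; apply: val_inj.
Qed.

Let entryDZ (A B : 'M[R]_1) t : (A + t *: B) 0 0 = A 0 0 + t * B 0 0.
Proof. by rewrite !mxE. Qed.

(** Induction on [#|D|] by eliminating one vector [a q]. A vector [v] good for [D :\ q] but not for
    [q] is tilted to [w], and the other vectors are moved along [a q] into the kernel of [w]. A
    solution or a dependence of the moved family is carried back; in a dependence, [a q] collects
    the nonnegative weight of all the moves. *)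
Lemma gordan (T : finType) N (a : T -> 'rV[R]_N) (D : {set T}) :
  (exists v : 'cV[R]_N, forall p, p \in D -> 0 < (a p *m v) 0 0) \/
  (exists l : T -> R, [/\ forall p, 0 <= l p, forall p, p \notin D -> l p = 0,
     exists p, l p != 0 & \sum_p l p *: a p = 0]).
Proof.
have [m] := ubnP #|D|; elim: m => // m IH in a D *; rewrite ltnS => Dm.
have [->|/set0Pn[q qD]] := eqVneq D finset.set0.
  by left; exists 0 => p; rewrite inE.
have Dq : (#|D :\ q| < m)%N by move: Dm; rewrite (cardsD1 q D) qD.
have [[v vP]|[l [l0 lD [p lp] sl]]] := IH a _ Dq; last first.
  right; exists l; split=> //; last by exists p.
  by move=> p' pD; apply: lD; rewrite !inE negb_and pD orbT.
have [q0|q0] := eqVneq (a q) 0.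
  right; exists (fun p => (p == q)%:R); split.
  - by move=> p; rewrite ler0n.
  - by move=> p pD; case: eqP pD qD => // ->; case: (q \in D).
  - by exists q; rewrite eqxx oner_neq0.
  - rewrite (bigD1 q) //= q0 scaler0 add0r big1 // => p pq.
    by rewrite (negPf pq) scale0r.
have [vq|vq] := ltP 0 ((a q *m v) 0 0).
  left; exists v => p pD; have [->//|pq] := eqVneq p q.
  by apply: vP; rewrite !inE pq.
have [w wP wq] : exists2 w : 'cV_N, (forall p, p \in D :\ q -> 0 < (a p *m w) 0 0) &
    (a q *m w) 0 0 < 0.
  have [e e0 eP] := @perturbation _ _ (fun p => p \in D :\ q)
    (fun p => (a p *m v) 0 0) (fun p => (a p *m (a q)^T) 0 0) vP.
  have E p : (a p *m (v - e *: (a q)^T)) 0 0 = (a p *m v) 0 0 - e * (a p *m (a q)^T) 0 0.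
    by rewrite mulmxBr -scalemxAr -scaleNr entryDZ mulNr.
  exists (v - e *: (a q)^T) => [p /eP[_]|]; first by rewrite E.
  by rewrite E; have := row_sqr_gt0 q0; nra.
(* Chosen so that [a p + t p *: a q] vanishes on [w]; it is positive for [p] in [D :\ q]. *)
pose t p := (a p *m w) 0 0 / - (a q *m w) 0 0.
have wq0 : (a q *m w) 0 0 != 0 by rewrite lt_eqF.
have [[v' v'P]|[l [l0 lD [p lp] sl]]] := IH (fun p => a p + t p *: a q) _ Dq.
  left; pose g := (a q *m v') 0 0.
  have [e e0 eP] := @perturbation _ _ (fun p => p \in D :\ q)
    (fun p => ((a p + t p *: a q) *m v') 0 0) t v'P.
  (* This multiple of [w] gives [a q] the value [e] and lowers the value of each moved vector at
     [v'] by [e * t p] only. *)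
  exists (v' + ((g - e) / - (a q *m w) 0 0) *: w) => p pD.
  have E p' : (a p' *m (v' + ((g - e) / - (a q *m w) 0 0) *: w)) 0 0 =
       (a p' *m v') 0 0 + ((g - e) / - (a q *m w) 0 0) * (a p' *m w) 0 0.
    by rewrite mulmxDr -scalemxAr entryDZ.
  have [->|pq] := eqVneq p q.
    rewrite E -/g (_ : _ + _ = e) //; field.
    by rewrite ?oppr_eq0 ?wq0.
  have pDq : p \in D :\ q by rewrite !inE pq.
  have [_] := eP p pDq; rewrite mulmxDl -scalemxAl entryDZ -/g E.
  suff -> : (g - e) / - (a q *m w) 0 0 * (a p *m w) 0 0 = t p * (g - e) by lra.
  by rewrite /t; field; rewrite ?oppr_eq0 ?wq0.
right; exists (fun p => l p + (p == q)%:R * \sum_(p' in D :\ q) l p' * t p').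
have lt0 p' : p' \in D :\ q -> 0 <= l p' * t p'.
  by move=> p'D; rewrite mulr_ge0 // divr_ge0 // ltW ?oppr_gt0 //; exact: wP.
split.
- by move=> p'; rewrite addr_ge0 // mulr_ge0 ?ler0n // sumr_ge0.
- move=> p' p'D; rewrite lD; last by rewrite !inE negb_and p'D orbT.
  by case: eqP p'D qD => [->|_ _ _]; [case: (q \in D)|rewrite mul0r addr0].
- exists p; apply/negP => /eqP h; have := l0 p.
  have : 0 <= (p == q)%:R * \sum_(p' in D :\ q) l p' * t p'.
    by rewrite mulr_ge0 ?ler0n // sumr_ge0.
  by have : l p != 0 by []; move/eqP; lra.
- rewrite -[RHS]sl; under eq_bigr do rewrite scalerDl.
  under [RHS]eq_bigr do rewrite scalerDr.
  rewrite !big_split /=; congr (_ + _).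
  rewrite (bigD1 q) //= eqxx mul1r [X in _ + X]big1 => [|p' pq]; last first.
    by rewrite (negPf pq) mul0r scale0r.
  rewrite addr0 scaler_suml [RHS](bigID (mem (D :\ q))) /= [X in _ = _ + X]big1 ?addr0.
    by apply: eq_bigr => p' _; rewrite scalerA.
  by move=> p' p'D; rewrite lD // scale0r.
Qed.

(* The equality constraints on [I] are absorbed by testing positivity on the
   cokernel of the rows indexed by [I]. *)
Lemma gordan_set m N (Q : 'M[R]_(m, N)) (I : {set 'I_m}) :
  (exists v : 'cV[R]_N, forall p, (p \in I -> (Q *m v) p 0 = 0) /\
                               (p \notin I -> 0 < (Q *m v) p 0)) \/
  (exists mu : 'rV[R]_m, [/\ mu *m Q = 0, forall p, p \notin I -> 0 <= mu 0 p
     & exists2 p, p \notin I & mu 0 p != 0]).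
Proof.
pose B := \matrix_(p < m) (if p \in I then row p Q else 0).
have [[v vP]|[l [l0 lD [p lp] sl]]] :=
  @gordan 'I_m N (fun p => row p Q *m cokermx B) (~: I).
  left; exists (cokermx B *m v) => p.
  have E : (Q *m (cokermx B *m v)) p 0 = (row p Q *m cokermx B *m v) 0 0.
    by rewrite -mulmxA -row_mul [RHS]mxE.
  split=> pI; last by rewrite E; apply: vP; rewrite inE.
  have := mulmx_coker B => /(congr1 (row p)); rewrite row_mul rowK pI row0.
  by rewrite E => ->; rewrite mul0mx mxE.
right; pose lr : 'rV[R]_m := \row_p l p.
have lrE : (\sum_p l p *: row p Q) = lr *m Q.
  by rewrite mulmx_sum_row; apply: eq_bigr => i _; rewrite mxE.
have /submxP[mu muE] : (lr *m Q <= B)%MS.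
  rewrite submxE -lrE mulmx_suml; apply/eqP; rewrite -[RHS]sl.
  by apply: eq_bigr => i _; rewrite -scalemxAl.
exists (lr - \row_i (if i \in I then mu 0 i else 0)); split.
- rewrite mulmxBl muE !mulmx_sum_row -sumrB big1 // => i _.
  by rewrite rowK mxE; case: ifP => _; rewrite ?subrr // scaler0 scale0r subrr.
- by move=> i iI; rewrite !mxE (negPf iI) subr0.
- have pI : p \notin I by apply: contraR lp => pI; rewrite lD // inE.
  by exists p; rewrite // !mxE (negPf pI) subr0.
Qed.

Definition row_generic m N (Q : 'M[R]_(m, N)) : Prop :=
  forall mu : 'rV[R]_m, (#|[set p | (mu 0 p != 0)%R]| <= N)%N -> mu *m Q = 0 -> mu = 0.

Definition select m (J : {set 'I_m}) : 'M[R]_(#|J|, m) :=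
  \matrix_(i, p) (enum_val i == p)%:R.

Lemma select_in m (J : {set 'I_m}) (w : 'rV[R]_#|J|) i : (w *m select J) 0 (enum_val i) = w 0 i.
Proof.
rewrite mxE (bigD1 i) //= mxE eqxx mulr1 big1 ?addr0 // => j ji.
by rewrite mxE (inj_eq enum_val_inj) (negPf ji) mulr0.
Qed.

Lemma select_out m (J : {set 'I_m}) (w : 'rV[R]_#|J|) p : p \notin J -> (w *m select J) 0 p = 0.
Proof.
move=> pJ; rewrite mxE big1 // => i _; rewrite mxE.
by case: eqP => [e|]; rewrite ?mulr0 //; rewrite -e enum_valP in pJ.
Qed.

Lemma row_select m N (Q : 'M[R]_(m, N)) (J : {set 'I_m}) i :
  row i (select J *m Q) = row (enum_val i) Q.
Proof.
rewrite row_mul [RHS]rowE; congr (_ *m _); apply/rowP => p.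
by rewrite !mxE eqxx eq_sym.
Qed.

Lemma select_free m N (Q : 'M[R]_(m, N)) (J : {set 'I_m}) :
  row_generic Q -> (#|J| <= N)%N -> row_free (select J *m Q).
Proof.
move=> gQ JN; rewrite -kermx_eq0; apply/eqP/row_matrixP => r.
have := congr1 (row r) (mulmx_ker (select J *m Q)); rewrite row_mul row0.
set w := row r _ => e; apply/rowP => i; rewrite -(select_in w) (gQ (w *m select J)).
- by rewrite row0 !mxE.
- apply: leq_trans JN; apply/subset_leq_card/subsetP => p.
  by rewrite inE; apply: contraR => /select_out ->.
- by rewrite -mulmxA.
Qed.

Lemma select_spans m N (Q : 'M[R]_(m, N)) (J : {set 'I_m}) (t : 'rV[R]_N) :
  row_generic Q -> #|J| = N ->
  exists2 nu : 'rV[R]_m, (forall p, p \notin J -> nu 0 p = 0) & nu *m Q = t.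
Proof.
move=> gQ JN; have fQ := select_free gQ (eq_leq JN).
have : row_full (select J *m Q)
  by rewrite -col_leq_rank -{1}JN; move: fQ; rewrite /row_free => /eqP ->.
move=> /(@submx_full _ _ _ _ t)/submxP[w ->].
by exists (w *m select J) => [p|]; [exact: select_out|rewrite mulmxA].
Qed.

(** By genericity the support of [mu] has more than [N] elements, so [N] rows [J] outside the zero
    set [Z] span the space. They express minus the sum of the rows in [Z], which yields a dependence
    [xi] equal to 1 on [Z]; a small multiple of it makes [mu] positive there without spoiling the
    other signs. *)
Lemma positive_dependence m N (Q : 'M[R]_(m, N)) (I : {set 'I_m}) (mu : 'rV[R]_m) :
  row_generic Q -> mu *m Q = 0 -> mu != 0 -> (forall p, p \notin I -> 0 <= mu 0 p) ->
  exists2 mu' : 'rV[R]_m, mu' *m Q = 0 & forall p, p \notin I -> 0 < mu' 0 p.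
Proof.
move=> gQ mQ m0 mI; pose Z := [set p | (p \notin I) && (mu 0 p == 0)].
have [J JZ JN] : exists2 J : {set 'I_m}, J \subset ~: Z & #|J| = N.
  have : (N <= #|~: Z|)%N.
    rewrite ltnW // ltnNge; apply: contra m0 => cZ; apply/eqP/gQ => //.
    apply: leq_trans cZ; apply/subset_leq_card/subsetP => p.
    by rewrite !inE => /negPf ->; rewrite andbF.
  by case/card_geqP => sq [us sz sub]; exists [set p in sq];
    [apply/subsetP => p; rewrite inE => /sub|rewrite cardsE; have /card_uniqP -> := us].
have [nu nJ nQ] := select_spans (- \sum_(p in Z) row p Q) gQ JN.
pose xi : 'rV[R]_m := \row_p ((p \in Z)%:R + nu 0 p).
have xQ : xi *m Q = 0.
  have -> : xi = \row_p (p \in Z)%:R + nu by apply/rowP => p; rewrite !mxE.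
  rewrite mulmxDl nQ mulmx_sum_row [X in _ - X]big_mkcond -sumrB big1 // => p _.
  by rewrite mxE; case: ifP => _; rewrite ?scale1r ?scale0r subrr.
have [|e e0 eP] := @perturbation R _ (fun p => (p \notin I) && (p \notin Z))
  (fun p => mu 0 p) (fun p => xi 0 p).
  move=> p /andP[pI]; rewrite inE pI /= => p0; rewrite lt_def p0 /=; exact: mI.
exists (mu + e *: xi); first by rewrite mulmxDl -scalemxAl mQ xQ scaler0 addr0.
move=> p pI; rewrite !mxE; have [pZ|pZ] := boolP (p \in Z); last first.
  by have [|h _] := eP p; [rewrite pI pZ|move: h; rewrite mxE (negPf pZ)].
rewrite nJ; last by apply/negP => /(subsetP JZ); rewrite inE pZ.
by move: pZ; rewrite inE => /andP[_ /eqP ->]; rewrite add0r addr0 mulr1.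
Qed.
End Gordan.

(** * General position of the partial sums *)

Section Position.
Local Open Scope ring_scope.
Variables (R : realFieldType) (n d : nat).
Implicit Types (x : 'I_n -> 'rV[R]_d) (s : 'S_n) (y : 'I_n -> R).

Definition psum x s (p : nat) : 'rV[R]_d := \sum_(q < n | (q < p)%N) x (s q).

Definition linear_relation x y : Prop := \sum_i y i *: x i = 0.

(** All orders [s] are required at once because the identity sums over them; the index [p.+1] leaves
    out the zero vector at position 0. *)
Definition in_general_position x : Prop :=
  forall s (D : {set 'I_n}), #|D| = d -> forall l : 'I_n -> R,
    (forall p, p \notin D -> l p = 0) ->
    \sum_(p < n) l p *: psum x s p.+1 = 0 -> forall p, l p = 0.

Lemma sum_psum x s (mu : 'I_n.+1 -> R) :
  \sum_(p < n.+1) mu p *: psum x s p =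
  \sum_(q < n) (\sum_(p < n.+1 | (q < p)%N) mu p) *: x (s q).
Proof.
under eq_bigr do rewrite scaler_sumr big_mkcond /=.
rewrite exchange_big /=; apply: eq_bigr => q _.
by rewrite scaler_suml [RHS]big_mkcond.
Qed.

Lemma loop_tail y s (q : nat) : (q <= n.+1)%N ->
  loop y s q = \sum_(p < n.+1 | (q <= p)%N) (loop y s p - loop y s p.+1).
Proof.
move=> qn; transitivity (\sum_(q <= p < n.+1) (loop y s p - loop y s p.+1)); last first.
  rewrite (big_nat_widenl _ 0) // big_mkord; apply: eq_bigl => p.
  by [].
under eq_bigr do rewrite -opprB.
by rewrite sumrN telescope_sumr // opprB /= ord_val_out // subr0.
Qed.

(** Abel summation: weights on the partial sums are differences of weights on the increments. *)
Lemma sum_loop_psum x s y :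
  \sum_(p < n.+1) (loop y s p - loop y s p.+1) *: psum x s p = \sum_i y i *: x i.
Proof.
rewrite sum_psum [RHS](reindex_inj (@perm_inj _ s)) /=; apply: eq_bigr => q _.
by rewrite -loop_tail /= ?ord_valE // ltnS ltnW // ltn_ord.
Qed.

Lemma sorting_perm (m : nat) (g : 'I_n -> 'I_m) :
  exists s, forall p q : 'I_n, (p <= q)%N -> (g (s q) <= g (s p))%N.
Proof.
pose r i j := (g j <= g i)%N.
have rt : total r by move=> i j; exact: leq_total.
have rr : transitive r by move=> i j k; rewrite /r => h1 h2; exact: leq_trans h1.
have rf : reflexive r by move=> i; exact: leqnn.
have rE i j : r i j -> (g j <= g i)%N by [].
pose t := sort r (enum 'I_n).
have tr : sorted r t by exact: sort_sorted.
have st : size t = n by rewrite size_sort size_enum_ord.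
have ut : uniq t by rewrite sort_uniq enum_uniq.
clearbody t; case: n g r {rt} rr rf rE t tr st ut => [|n'] g r rr rf rE t tr st ut.
  by exists 1%g => -[].
have inj : injective (fun q : 'I_n'.+1 => nth ord0 t q).
  move=> p q /eqP; rewrite nth_uniq ?st ?ltn_ord // => /eqP; exact: val_inj.
exists (perm inj) => p q pq; rewrite !permE.
by apply/rE/(sorted_leq_nth rr rf ord0 tr); rewrite ?inE ?st.
Qed.

Hypothesis dn : (d <= n)%N.

(** Visit the coordinates by decreasing label, so that equal labels are adjacent and the label
    [ord0] comes last, next to the closing 0. The loop then drops only at the last member of each
    class of nonzero label, at most [d] times, and its drops are a dependence of at most [d] partial
    sums. *)
Lemma linear_relation_few_values x (g : 'I_n -> 'I_d.+1) (c : 'I_d.+1 -> R) :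
  in_general_position x -> c ord0 = 0 -> linear_relation x (fun i => c (g i)) ->
  forall i, c (g i) = 0.
Proof.
move=> gx c0 Uc; have [s sg] := sorting_perm g; pose y i := c (g i).
pose l (p : 'I_n) := loop y s p.+1 - loop y s p.+2.
pose J := [set p : 'I_n | l p != 0].
have yE (p : 'I_n) : loop y s p.+1 = y (s p) by rewrite /= ord_valE.
have yS (p q : 'I_n) : (p < q)%N -> g (s q) = g (s p) -> l p = 0.
  move=> pq e; have p1 : (p.+1 < n)%N by apply: leq_ltn_trans pq _.
  rewrite /l yE -[p.+2]/((Ordinal p1).+1) yE /y.
  suff -> : g (s (Ordinal p1)) = g (s p) by rewrite subrr.
  apply/eqP; rewrite -val_eqE eqn_leq /=; apply/andP; split; first exact: sg.
  by rewrite -e; exact: sg.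
have J0 p : p \in J -> g (s p) != ord0.
  rewrite inE; apply: contraNneq => e; rewrite /l yE /y e c0 sub0r oppr_eq0.
  have [p1|np] := ltnP p.+1 n; last by rewrite /= ord_val_out.
  rewrite -[p.+2]/((Ordinal p1).+1) yE /y.
  have := sg p (Ordinal p1) (leqnSn _); rewrite e leqn0 => /eqP h.
  by rewrite (_ : g _ = ord0) ?c0 //; apply: val_inj.
have JJ : {in J &, injective (fun p => g (s p))}.
  move=> p q pJ qJ e; apply: val_inj; have [pq|qp|//] := ltngtP p q.
    by move: pJ; rewrite inE (yS p q) ?eqxx.
  by move: qJ; rewrite inE (yS q p) ?eqxx.
have Jd : (#|J| <= d)%N.
  have <- : #|[set~ (ord0 : 'I_d.+1)]| = d by rewrite cardsC1 card_ord.
  rewrite -(card_in_imset JJ).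
  by apply/subset_leq_card/subsetP => _ /imsetP[p pJ ->]; rewrite !inE J0.
have [D JD Dd] : exists2 D : {set 'I_n}, J \subset D & #|D| = d.
  have : (d - #|J| <= #|~: J|)%N by rewrite leq_subLR cardsC card_ord.
  case/card_geqP => sq [us sz sub]; exists (J :|: [set p in sq]); first exact: finset.subsetUl.
  rewrite cardsU (_ : #|[set p in sq]| = d - #|J|)%N; last by rewrite cardsE -sz; exact/card_uniqP.
  have -> : J :&: [set p in sq] = finset.set0.
    by apply/setP => p; rewrite !inE; apply/andP => -[pJ /sub]; rewrite !inE pJ.
  by rewrite cards0 subn0 subnKC.
have l0 p : l p = 0.
  apply: (gx s D Dd).
    by move=> q qD; apply/eqP; apply: contraNT qD => lq; apply: (subsetP JD); rewrite inE.
  have := sum_loop_psum x s y; rewrite big_ord_recl {1}/psum big_pred0 // scaler0 add0r.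
  by rewrite [RHS]Uc => e; rewrite -[RHS]e; apply: eq_bigr.
suff y0 q : loop y s q.+1 = 0.
  by move=> i; have := y0 (s^-1%g i); rewrite yE permKV.
have [qn|] := ltnP q n; last by move=> h; rewrite /= ord_val_out.
rewrite loop_tail ?ltnS 1?ltnW // big1 // => p qp; case: p qp => [[|p]] // pn _.
exact: (l0 (Ordinal (pn : (p < n)%N))).
Qed.

(** For the second condition, the class sums of the increments over the [d] nonzero labels form a
    square matrix. The first condition makes it invertible, so the label constants can be solved
    for. *)
Lemma generic_linear_relation x : in_general_position x -> generic d (linear_relation x).
Proof.
move=> gx; have K := linear_relation_few_values gx.
split.
- split; first by rewrite /linear_relation big1 // => i _; rewrite scale0r.
  move=> a y1 y2 U1 U2; rewrite /linear_relation; under eq_bigr do rewrite scalerDl -scalerA.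
  by rewrite big_split /= -scaler_sumr [X in _ *: X]U1 scaler0 add0r.
- by move=> g c; apply: K.
- move=> g gs z; pose X : 'M[R]_d := \matrix_j \sum_(i | g i == lift ord0 j) x i.
  pose cv (v : 'rV[R]_d) k := oapp (fun j => v 0 j) 0 (unlift ord0 k).
  have cE v : \sum_i cv v (g i) *: x i = v *m X.
    rewrite mulmx_sum_row (partition_big g xpredT) //= big_ord_recl.
    rewrite [X in X + _]big1 ?add0r => [|i /eqP ->]; last first.
      by rewrite /cv unlift_none scale0r.
    apply: eq_bigr => j _; rewrite rowK scaler_sumr; apply: eq_bigr => i /eqP ->.
    by rewrite /cv liftK.
  have uX : X \in unitmx.
    rewrite -row_free_unit -kermx_eq0; apply/eqP/row_matrixP => r.
    have := congr1 (row r) (mulmx_ker X); rewrite row_mul !row0 -cE => e.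
    apply/rowP => j; have [i gi] := gs (lift ord0 j) isT.
    have := K g (cv (row r (kermx X))) _ e i; rewrite /cv unlift_none gi liftK /= => -> //.
    by rewrite mxE.
  pose v := - (\sum_i z i *: x i) *m invmx X.
  exists (cv v); split; first by rewrite /cv unlift_none.
  rewrite /linear_relation; under eq_bigr do rewrite scalerDl.
  by rewrite big_split /= cE mulmxKV // subrr.
Qed.

(** The appended coordinate 1 turns affine dependences into linear ones and the constant of a
    hyperplane into a coordinate of its normal. *)
Definition lifted x s : 'M[R]_(n.+1, d + 1) := \matrix_(p < n.+1) row_mx (psum x s p) 1%:M.

Lemma mul_lifted x s (mu : 'rV[R]_n.+1) :
  mu *m lifted x s = row_mx (\sum_p mu 0 p *: psum x s p) ((\sum_p mu 0 p)%:M).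
Proof.
apply/rowP => j; rewrite !mxE; under eq_bigr do rewrite !mxE.
case: splitP => k _; first by rewrite summxE; apply: eq_bigr => p _; rewrite mxE.
by under eq_bigr do rewrite ord1 mxE eqxx mulr1; rewrite ord1 mxE eqxx mulr1n.
Qed.

Lemma mul_lifted_eq0 x s (mu : 'rV[R]_n.+1) :
  mu *m lifted x s = 0 <-> \sum_p mu 0 p *: psum x s p = 0 /\ \sum_p mu 0 p = 0.
Proof.
rewrite mul_lifted -row_mx0; split=> [/eq_row_mx[-> /matrixP/(_ 0 0)]|[-> ->]].
  by rewrite !mxE eqxx mulr1n.
by congr row_mx; apply/matrixP => i j; rewrite !mxE mul0rn.
Qed.

(* An affine dependence [mu] of the points [S_p] is the difference sequence of a
   vector [y] of linear dependences of the increments, closed up at 0. *)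
Lemma dependence_loop x s (mu : 'rV[R]_n.+1) :
  mu *m lifted x s = 0 ->
  exists2 y, linear_relation x y & forall p : nat, (p <= n.+1)%N ->
    loop y s p = \sum_(q < n.+1 | (p <= q)%N) mu 0 q.
Proof.
move=> /mul_lifted_eq0[m1 m2].
exists (fun i => \sum_(q < n.+1 | (s^-1%g i < q)%N) mu 0 q).
  rewrite /linear_relation (reindex_inj (@perm_inj _ s)) /= -[RHS]m1 sum_psum.
  by apply: eq_bigr => q _; rewrite permK.
case=> [|p] pn /=; first by rewrite m2.
have [pn'|np] := ltnP p n; last first.
  rewrite ord_val_out // big_pred0 // => q; apply/negbTE; rewrite -ltnNge.
  exact: leq_trans (ltn_ord q) _.
rewrite -[p in ord_val _ p]/(nat_of_ord (Ordinal pn')) ord_valE permK.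
by apply: eq_bigl.
Qed.

Lemma loop_dependence x s y : linear_relation x y ->
  (\row_(p < n.+1) (loop y s p - loop y s p.+1)) *m lifted x s = 0.
Proof.
move=> Uy; apply/mul_lifted_eq0; split.
  by under eq_bigr do rewrite mxE; rewrite sum_loop_psum.
under eq_bigr do rewrite mxE.
by have := @loop_tail y s 0 (leq0n _) => /= <-.
Qed.

(** The vector [y] of a dependence [mu] consists of tail sums, which change only at the support of
    [mu]. The tail from the first support point is the total sum 0, so a support of [d.+1] points
    leaves at most [d] nonzero values, and [linear_relation_few_values] applies. *)
Lemma row_generic_lifted x s : in_general_position x -> row_generic (lifted x s).
Proof.
move=> gx mu; pose D := [set p | mu 0 p != 0]; rewrite -/D => Dd m0.
have {}Dd : (#|D| <= d.+1)%N by rewrite -[d.+1]addn1.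
have [D0|/set0Pn[r0 r0D]] := eqVneq D finset.set0.
  by apply/rowP => p; rewrite mxE; apply/eqP; have := in_set0 p; rewrite -D0 inE => /negPn.
have [y Uy yl] := dependence_loop m0.
pose T (r : 'I_n.+1) := \sum_(q < n.+1 | (r <= q)%N) mu 0 q.
case: (arg_minnP (fun r : 'I_n.+1 => r : nat) r0D) => r1 /= r1D r1min.
have {}r1D : r1 \in D by [].
have tail (p : nat) (r : 'I_n.+1) : (p <= r)%N ->
    (forall q : 'I_n.+1, q \in D -> (p <= q)%N -> (r <= q)%N) ->
    \sum_(q < n.+1 | (p <= q)%N) mu 0 q = T r.
  move=> pr h; rewrite /T [LHS]big_mkcond [RHS]big_mkcond; apply: eq_bigr => q _.
  have [rq|qr] := leqP r q; first by rewrite (leq_trans pr rq).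
  case: ifP => // pq; apply/eqP/negPn/negP => mq.
  by have := h q _ pq; rewrite inE mq leqNgt qr => /(_ isT).
have m2 : \sum_(q < n.+1) mu 0 q = 0 by have [] := (mul_lifted_eq0 x s mu).1 m0.
have T1 : T r1 = 0.
  by rewrite -(tail 0%N r1) // => q qD _; exact: r1min.
pose vals := [seq T r | r <- enum (D :\ r1)].
have sv : (size vals <= d)%N.
  by rewrite size_map -cardE; move: Dd; rewrite (cardsD1 r1 D) r1D.
have yv i : y i = 0 \/ y i \in vals.
  have := yl (s^-1%g i).+1; rewrite ltnS ltnW ?ltn_ord // => /(_ isT).
  rewrite /= ord_valE permKV => ->.
  case: (pickP [pred q : 'I_n.+1 | (q \in D) && (s^-1%g i < q)%N]) => [q0 q0P|none]; last first.
    left; rewrite big1 // => q qi; apply/eqP/negPn/negP => mq.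
    by have := none q; rewrite /= inE mq qi.
  case: (arg_minnP (fun r : 'I_n.+1 => r : nat) q0P) => q /andP[qD qi] qmin.
  rewrite (tail _ q) //; last by move=> q' q'D q'i; apply: qmin; rewrite /= q'D.
  have [->|qr1] := eqVneq q r1; first by left.
  by right; apply/map_f; rewrite mem_enum !inE qr1; move: qD; rewrite inE.
have y0 i : y i = 0.
  pose g i : 'I_d.+1 := inord (if y i == 0 then 0%N else (index (y i) vals).+1).
  pose c (k : 'I_d.+1) := nth 0 (0 :: vals) k.
  have cg j : c (g j) = y j.
    rewrite /c /g; have [->|yj] := eqVneq (y j) 0; first by rewrite inordK.
    have yv' : y j \in vals by case: (yv j) => // /eqP; rewrite (negPf yj).
    by rewrite inordK /= ?nth_index // ltnS; apply: leq_trans sv; rewrite index_mem.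
  rewrite -cg; apply: (linear_relation_few_values gx) => //.
  by rewrite (_ : (fun i => _) = y) //; apply: funext.
have ly q : loop y s q = 0 by case: q => //= q; rewrite /ord_val; case: insub.
apply/rowP => p; rewrite mxE.
have E : T p = mu 0 p + \sum_(q < n.+1 | (p < q)%N) mu 0 q.
  rewrite /T (bigD1 p) //=; congr (_ + _); apply: eq_bigl => q.
  by rewrite ltn_neqAle andbC eq_sym.
have pn : (p <= n.+1)%N by apply: ltnW.
by move: E; rewrite /T -(yl p pn) -(yl p.+1 (ltn_ord p)) !ly addr0.
Qed.

Definition exposed x s (I : {set 'I_n.+1}) : Prop :=
  exists (u : 'rV[R]_d) (c : R), forall p : 'I_n.+1,
    (p \in I -> \sum_(j < d) u 0 j * psum x s p 0 j = c) /\
    (p \notin I -> \sum_(j < d) u 0 j * psum x s p 0 j < c).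

Lemma lifted_mul x s (v : 'cV[R]_(d + 1)) p :
  (lifted x s *m v) p 0 = \sum_(j < d) v (lshift 1 j) 0 * psum x s p 0 j + v (rshift d 0) 0.
Proof.
rewrite mxE big_split_ord /= big_ord1; congr (_ + _).
  by apply: eq_bigr => j _; rewrite mxE row_mxEl mulrC.
by rewrite mxE row_mxEr mxE eqxx mul1r.
Qed.

Lemma exposedP x s I :
  exposed x s I <->
  exists v : 'cV[R]_(d + 1), forall p, (p \in I -> (lifted x s *m v) p 0 = 0) /\
                                     (p \notin I -> 0 < (lifted x s *m v) p 0).
Proof.
split=> [[u [c uc]]|[v vP]].
  exists (col_mx (- u^T) c%:M) => p; have [h1 h2] := uc p.
  have -> : (lifted x s *m col_mx (- u^T) c%:M) p 0 = c - \sum_(j < d) u 0 j * psum x s p 0 j.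
    rewrite lifted_mul col_mxEd mxE eqxx mulr1n addrC -sumrN; congr (_ + _).
    by apply: eq_bigr => j _; rewrite col_mxEu !mxE mulNr.
  by split=> [/h1 ->|/h2]; rewrite ?subrr // subr_gt0.
exists (- \row_j v (lshift 1 j) 0), (v (rshift d 0) 0) => p; have := vP p.
rewrite lifted_mul (_ : \sum_(j < d) v _ _ * _ =
    - \sum_(j < d) (- \row_j v (lshift 1 j) 0) 0 j * psum x s p 0 j).
  by case=> h1 h2; split=> [/h1|/h2]; lra.
by rewrite -sumrN; apply: eq_bigr => j _; rewrite !mxE mulNr opprK.
Qed.

(** A supporting functional and a descending relation exclude each other, since their pairing would
    be both zero and positive. Conversely Gordan gives only weak descent, which
    [positive_dependence] makes strict. The full set is excluded: it is exposed by the zero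
    functional and hit by the zero relation. *)
Lemma exposed_hit x s I : in_general_position x -> I != [set: 'I_n.+1] ->
  hit (linear_relation x) s I = ~~ `[< exposed x s I >].
Proof.
move=> gx IT; have gQ := row_generic_lifted (s := s) gx; apply/asboolP/asboolPn.
  move=> [y [Uy D]] /exposedP[v vP].
  have /(congr1 (fun M => (M *m v) 0 0)) := loop_dependence s Uy.
  rewrite -mulmxA mul0mx mxE [RHS]mxE => /eqP; apply/negP; rewrite gt_eqF //.
  have [p pI] : exists p, p \notin I.
    by apply/existsP; rewrite -negb_forall; apply: contra IT => /forallP h;
      apply/eqP/setP => p; rewrite inE h.
  have t0 q : 0 <= (\row_(p < n.+1) (loop y s p - loop y s p.+1)) 0 q * (lifted x s *m v) q 0.
    have [v0 v1] := vP q; have [qI|qI] := boolP (q \in I); first by rewrite v0 // mulr0.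
    by rewrite mulr_ge0 ?ltW ?v1 // mxE subr_gt0; apply: D.
  rewrite (bigD1 p) //= ltr_pwDl ?sumr_ge0 //.
  by rewrite mulr_gt0 ?(vP p).2 // mxE subr_gt0; apply: D.
move=> ne; have [/exposedP//|[mu [mQ m0 [p pI mp]]]] := gordan_set (lifted x s) I.
have [|mu' mQ' m'] := positive_dependence gQ mQ _ m0.
  by apply: contraNneq mp => ->; rewrite mxE.
have [y Uy yl] := dependence_loop mQ'; exists y; split=> // q qI.
rewrite !yl //; last exact: ltnW.
have -> : \sum_(q' < n.+1 | (q <= q')%N) mu' 0 q' =
    mu' 0 q + \sum_(q' < n.+1 | (q < q')%N) mu' 0 q'.
  rewrite (bigD1 q) //=; congr (_ + _); apply: eq_bigl => q'.
  by rewrite ltn_neqAle andbC eq_sym.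
by rewrite ltrDr m'.
Qed.
End Position.

From mathcomp Require Import finmap.
From mathcomp Require Import all_classical all_reals all_analysis.
From mathcomp Require Import measurable_realfun.

Local Open Scope classical_set_scope.
Local Open Scope ring_scope.

(** * Faces of the convex hull *)

Section Hull.
Variables (R : realType) (d : nat).
Implicit Types (A B : set 'rV[R]_d) (u x y : 'rV[R]_d).

Definition dot u x : R := \sum_(j < d) u 0 j * x 0 j.

Lemma dotD u x y : dot u (x + y) = dot u x + dot u y.
Proof. by rewrite -big_split; apply: eq_bigr => j _; rewrite mxE mulrDr. Qed.

Lemma dotZ u a x : dot u (a *: x) = a * dot u x.
Proof. by rewrite /dot mulr_sumr; apply: eq_bigr => j _; rewrite mxE mulrCA. Qed.

Lemma convex_setP A :
  @convex_set R 'rV[R]_d A <->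
  forall x y t, 0 <= t -> t <= 1 -> A x -> A y -> A (t *: x + (1 - t) *: y).
Proof.
split=> [cA x y t t0 t1 Ax Ay|cA x y t /set_mem Ax /set_mem Ay].
  have /set_mem := cA x y (Itv01 t0 t1) (mem_set Ax) (mem_set Ay).
  by [].
by apply/mem_set; exact: cA.
Qed.

Lemma convex_hull_convex A : @convex_set R 'rV[R]_d (convex_hull A).
Proof.
apply/convex_setP => x y t t0 t1 hx hy B [cB AB].
by apply: (convex_setP B).1 => //; [apply: hx|apply: hy].
Qed.

Lemma sub_convex_hull A : A `<=` convex_hull A.
Proof. exact: sub_gen_smallest. Qed.

Lemma convex_hull_sub A B : @convex_set R 'rV[R]_d B -> A `<=` B -> convex_hull A `<=` B.
Proof. exact: smallest_sub. Qed.

Lemma convex_halfspace u (c : R) : @convex_set R 'rV[R]_d [set x | dot u x <= c].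
Proof. by apply/convex_setP => x y t t0 t1 /= hx hy; rewrite dotD !dotZ; nra. Qed.

Variables (m : nat) (S : 'I_m -> 'rV[R]_d).
Implicit Types (I J : {set 'I_m}).

Definition simplex I : set 'rV[R]_d := convex_hull [set S p | p in [set p | p \in I]].

Definition supports u (c : R) I : Prop :=
  forall p, (p \in I -> dot u (S p) = c) /\ (p \notin I -> dot u (S p) < c).

Let C := simplex finset.setT.

Lemma vertex_simplex I p : p \in I -> simplex I (S p).
Proof. by move=> pI; apply: sub_convex_hull; exists p. Qed.

Lemma simplex_sub I B : @convex_set R 'rV[R]_d B -> (forall p, p \in I -> B (S p)) ->
  simplex I `<=` B.
Proof. by move=> cB h; apply: convex_hull_sub => // _ [p pI <-]; apply: h. Qed.

Lemma supports_le u c I : supports u c I -> C `<=` [set x | dot u x <= c].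
Proof.
move=> uc; apply: simplex_sub; first exact: convex_halfspace.
move=> p _ /=; have [h1 h2] := uc p; have [pI|pI] := boolP (p \in I).
  by rewrite h1.
exact/ltW/h2.
Qed.

Lemma simplex_level u c I : supports u c I -> simplex I `<=` [set x | dot u x = c].
Proof.
move=> uc; apply: simplex_sub; last by move=> p pI; have [h _] := uc p; exact: h.
by apply/convex_setP => x y t t0 t1 /= hx hy; rewrite dotD !dotZ hx hy; ring.
Qed.

(* The union of an open half-space and a convex subset of its boundary
   hyperplane is convex. *)
Lemma supports_slice u c I : supports u c I -> C `&` [set x | dot u x = c] = simplex I.
Proof.
move=> uc; have lev := simplex_level uc.
apply/seteqP; split=> [x [Cx /= xc]|x Ix]; last first.
  split; last exact: lev.
  by move: x Ix; apply: simplex_sub; [exact: convex_hull_convex|move=> p _; exact: vertex_simplex].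
pose D : set 'rV[R]_d := [set x | dot u x < c \/ simplex I x].
suff : D x by case=> //; rewrite xc ltxx.
move: x Cx {xc}; apply: simplex_sub; last first.
  move=> p _; have [h1 h2] := uc p; have [pI|pI] := boolP (p \in I).
    by right; exact: vertex_simplex.
  by left; exact: h2.
apply/convex_setP => x y t t0 t1 Dx Dy.
have le z : D z -> dot u z <= c by case=> [/ltW//|/lev /= ->].
have [->|tn0] := eqVneq t 0; first by rewrite scale0r add0r subr0 scale1r.
have [->|tn1] := eqVneq t 1; first by rewrite scale1r subrr scale0r addr0.
have t0' : 0 < t by rewrite lt_def tn0.
have t1' : t < 1 by rewrite lt_def eq_sym tn1.
have lx := le _ Dx; have ly := le _ Dy.
case: Dx => [xc|Ix]; first by left; rewrite dotD !dotZ; nra.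
case: Dy => [yc|Iy]; first by left; rewrite dotD !dotZ; nra.
by right; apply: (convex_setP (simplex I)).1 => //; exact: convex_hull_convex.
Qed.

Lemma is_faceP F :
  is_face C F <-> exists u c I, supports u c I /\ F = simplex I.
Proof.
split=> [[u [c [Cc ->]]]|[u [c [I [uc ->]]]]].
  exists u, c, [set p | dot u (S p) == c]%SET.
  have uc : supports u c [set p | dot u (S p) == c]%SET.
    move=> p; rewrite inE; split=> [/eqP//|pc].
    by rewrite lt_neqAle pc Cc //; apply: vertex_simplex; rewrite inE.
  by split=> //; exact: supports_slice.
by exists u, c; split; [exact: supports_le uc|rewrite -(supports_slice uc)].
Qed.

Lemma supports_mem u c I p : supports u c I -> simplex I (S p) -> p \in I.
Proof.
move=> uc /(simplex_level uc) /= h; apply: contraT => /(uc p).2.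
by rewrite h ltxx.
Qed.

Definition directions I p0 : (#|I :\ p0|%SET).-tuple 'rV[R]_d :=
  [tuple S (enum_val i) - S p0 | i < #|I :\ p0|%SET].

Lemma mem_directions I p0 p : p \in I -> S p - S p0 \in <<directions I p0>>%VS.
Proof.
move=> pI; have [->|pp0] := eqVneq p p0; first by rewrite subrr mem0v.
have pJ : p \in (I :\ p0)%SET by rewrite !inE pp0.
apply: memv_span; apply/tnthP; exists (enum_rank_in pJ p).
by rewrite tnth_mktuple enum_rankK_in.
Qed.

Lemma affine_hull_simplex I p0 : p0 \in I ->
  affine_hull (simplex I) = [set x | x - S p0 \in <<directions I p0>>%VS].
Proof.
move=> p0I; apply/seteqP; split.
  apply: smallest_sub.
    move=> x y t /= hx hy.
    have -> : (1 - t) *: x + t *: y - S p0 = (1 - t) *: (x - S p0) + t *: (y - S p0).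
      by rewrite !scalerBr addrACA -opprD -scalerDl subrK scale1r.
    by rewrite rpredD // rpredZ.
  apply: simplex_sub; last by move=> p pI /=; exact: mem_directions.
  apply/convex_setP => x y t t0 t1 /= hx hy.
  have -> : t *: x + (1 - t) *: y - S p0 = t *: (x - S p0) + (1 - t) *: (y - S p0).
    by rewrite !scalerBr addrACA -opprD -scalerDl [t + _]addrC subrK scale1r.
  by rewrite rpredD // rpredZ.
move=> x; rewrite /mkset => hx A [aA IA]; rewrite -[x](subrK (S p0)).
pose L v := A (v + S p0).
have L0 : L 0 by rewrite /L add0r; apply: IA; exact: vertex_simplex.
have LZ t v : L v -> L (t *: v).
  move=> Lv; have := aA _ _ t L0 Lv; rewrite /L add0r.
  by rewrite scalerDr addrCA -scalerDl subrK scale1r.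
have LD v w : L v -> L w -> L (v + w).
  move=> Lv Lw.
  (* The affine combination available is the midpoint; the sum is its double, by [LZ]. *)
  have h : L (2^-1 *: v + 2^-1 *: w).
    have := aA _ _ 2^-1 Lv Lw; rewrite /L !scalerDr addrACA -scalerDl subrK scale1r.
    by rewrite (_ : 1 - 2^-1 = 2^-1 :> R) //; lra.
  by have := LZ 2 _ h; rewrite scalerDr !scalerA divff // !scale1r.
rewrite -/(L _) (coord_span hx).
elim/big_ind: _ => [//|v w|i _]; first exact: LD.
apply: LZ; rewrite -tnth_nth tnth_mktuple /L subrK; apply: (IA); apply: vertex_simplex.
by have := enum_valP i; rewrite !inE => /andP[].
Qed.

Let Q : 'M[R]_(m, d + 1) := \matrix_(p < m) row_mx (S p) 1%:M.

Hypotheses (gS : row_generic Q) (dm : (d < m)%N).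

(** A relation among the directions, with minus the sum of its coefficients placed at [p0], is an
    affine dependence supported on [I]. *)
Lemma directions_free I p0 : p0 \in I -> (#|I| <= d.+1)%N -> free (directions I p0).
Proof.
move=> p0I Id; apply/freeP => k k0 i.
pose J := (I :\ p0)%SET; pose w : 'rV[R]_#|J| := \row_i k i.
pose mu := w *m select R J - (\sum_i k i) *: delta_mx 0 p0.
have p0J : p0 \notin J by rewrite !inE eqxx.
have mu0 : mu = 0.
  apply: gS.
    rewrite addn1; apply: leq_trans Id; apply/subset_leq_card/fintype.subsetP => p.
    rewrite inE; apply: contraR => pI.
    rewrite mxE select_out; last by rewrite !inE (negPf pI) andbF.
    rewrite !mxE [p == p0]negbTE ?andbF ?mulr0 ?subr0 //.
    by apply: contraNneq pI => ->.
  have rQ p : row p Q = row_mx (S p) 1%:M by rewrite rowK.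
  rewrite mulmxBl -mulmxA mulmx_sum_row -scalemxAl -rowE rQ.
  under eq_bigr do rewrite row_select rQ mxE.
  rewrite scaler_suml -sumrB.
  under eq_bigr do rewrite -scalerBr opp_row_mx add_row_mx subrr scale_row_mx scaler0.
  have sumE (V : 'I_(#|J|) -> 'rV[R]_d) : \sum_j row_mx (V j) (0 : 'M[R]_1) = row_mx (\sum_j V j) 0.
    by elim/big_rec2: _ => [|j A B _ ->]; rewrite ?row_mx0 // add_row_mx addr0.
  rewrite sumE -[RHS]row_mx0; congr row_mx; rewrite -[RHS]k0.
  by apply: eq_bigr => j _; rewrite -tnth_nth tnth_mktuple.
have := congr1 (fun M : 'rV_m => M 0 (enum_val i)) mu0.
rewrite mxE select_in !mxE [_ == p0]negbTE ?andbF ?mulr0 ?subr0 //.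
by apply: contraNneq p0J => <-; exact: enum_valP.
Qed.

Lemma dim_directions_small I p0 : p0 \in I -> (#|I| <= d.+1)%N ->
  \dim <<directions I p0>>%VS = #|I|.-1.
Proof.
move=> p0I Id; have /eqP -> := directions_free p0I Id.
by rewrite size_tuple (cardsD1 p0 I) p0I.
Qed.

(** A set of more than [d.+1] points contains [p0] and [d] further points in general position, which
    already span dimension [d]; a smaller dimension therefore bounds [#|I|]. *)
Lemma dim_directions I p0 : p0 \in I -> (\dim <<directions I p0>>%VS < d)%N ->
  #|I| = (\dim <<directions I p0>>%VS).+1.
Proof.
move=> p0I dI; have I0 : (0 < #|I|)%N by apply/card_gt0P; exists p0.
have [Id|dI'] := leqP #|I| d.+1; first by rewrite dim_directions_small // prednK.
have [J JI Jd] : exists2 J : {set 'I_m}, J \subset (I :\ p0)%SET & #|J| = d.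
  have : (d <= #|I :\ p0|%SET)%N by move: dI'; rewrite (cardsD1 p0 I) p0I ltnS => /ltnW.
  case/card_geqP => sq [us sz sub]; exists [set p in sq]%SET.
    by apply/fintype.subsetP => p; rewrite inE => /sub.
  by rewrite cardsE -sz; exact/card_uniqP.
have p0J : p0 \notin J by apply/negP => /(fintype.subsetP JI); rewrite !inE eqxx.
have := @dim_directions_small (p0 |: J)%SET p0 (finset.setU11 _ _).
rewrite cardsU1 p0J Jd => /(_ (leqnn _)) /= dJ.
suff : (\dim <<directions (p0 |: J)%SET p0>>%VS <= \dim <<directions I p0>>%VS)%N.
  by rewrite dJ leqNgt dI.
apply/dimvS/span_subvP => v /tnthP[j ->]; rewrite tnth_mktuple; apply: mem_directions.
have := enum_valP j; rewrite !inE => /andP[/negPf ->] /= /(fintype.subsetP JI).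
by rewrite !inE => /andP[].
Qed.

Lemma simplex0 : simplex finset.set0 = set0.
Proof.
apply/seteqP; split=> //; apply: simplex_sub; last by move=> p; rewrite inE.
by apply/convex_setP.
Qed.

Lemma has_dim_simplex I k : (k < d)%N -> has_dim (simplex I) k <-> #|I| = k.+1.
Proof.
move=> kd; split=> [[x0 [V [aV dV]]]|Ik].
  have [I0|/set0Pn[p0 p0I]] := eqVneq I finset.set0.
    have : affine_hull (simplex I) `<=` set0.
      by rewrite I0 simplex0; apply: smallest_sub.
    by rewrite aV => /(_ x0); case; rewrite /= subrr mem0v.
  have E x : (x - x0 \in V) = (x - S p0 \in <<directions I p0>>%VS).
    have := affine_hull_simplex p0I; rewrite aV => /seteqP[h1 h2].
    by apply/idP/idP => [/h1|/h2].
  have VE : V = <<directions I p0>>%VS.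
    have p0V : S p0 - x0 \in V by rewrite E subrr mem0v.
    apply/vspaceP => v; have := E (v + S p0); rewrite addrK => <-.
    by rewrite -addrA rpredDr.
  by rewrite -dV VE; apply: dim_directions => //; rewrite -VE dV.
have [p0 p0I] : exists p0, p0 \in I by apply/card_gt0P; rewrite Ik.
exists (S p0), <<directions I p0>>%VS; split; first exact: affine_hull_simplex.
by rewrite dim_directions_small ?Ik // ltnW.
Qed.

Lemma face_number_simplex k : (k < d)%N ->
  face_number C k = #|[set I : {set 'I_m} | (#|I| == k.+1) &&
                        `[< exists u c, supports u c I >]]|%SET.
Proof.
move=> kd; set X := [set I | _]%SET.
have XP I : reflect (#|I| = k.+1 /\ exists u c, supports u c I) (I \in X).
  rewrite inE; apply: (iffP andP) => [[/eqP h /asboolP]|[-> ?]]; first by split.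
  by split; [exact: eqxx|exact/asboolP].
rewrite /face_number.
have -> : [set F | is_face C F /\ has_dim F k] = [set` [fset simplex I | I in X]%fset].
  apply/seteqP; split=> F /=.
    move=> [/is_faceP[u [c [I [uc ->]]]] /(has_dim_simplex _ kd) Ik].
    by apply/imfsetP; exists I => //=; apply/XP; split => //; exists u, c.
  move=> /imfsetP[I /= /XP[Ik [u [c uc]]] ->]; split; last exact/has_dim_simplex.
  by apply/is_faceP; exists u, c, I.
rewrite set_fsetK card_in_imfset /=; first by rewrite -cardE.
(* A supported set is recovered from its simplex as the set of all indices whose points lie in
   it. *)
move=> I J /XP[_ [u [c uI]]] /XP[_ [v [e vJ]]] IJ.
apply/setP => p; apply/idP/idP => pI.
  by apply: (supports_mem vJ); rewrite -IJ; exact: vertex_simplex.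
by apply: (supports_mem uI); rewrite IJ; exact: vertex_simplex.
Qed.

End Hull.

(** * Face numbers summed over all orders *)

Section FaceCount.
Variables (R : realType) (n d : nat) (x : 'I_n -> 'rV[R]_d) (k : nat).
Hypotheses (dn : (d <= n)%N) (gx : in_general_position x) (kd : (k < d)%N).

Lemma face_number_exposed s :
  face_number (convex_hull [set psum x s p | p in [set p | (p <= n)%N]]) k =
  (\sum_(I : {set 'I_n.+1}) (((#|I| == k.+1) && `[< exposed x s I >]) : nat))%N.
Proof.
have -> : convex_hull [set psum x s p | p in [set p | (p <= n)%N]] =
    simplex (fun p : 'I_n.+1 => psum x s p) finset.setT.
  congr convex_hull; apply/seteqP; split=> v /= [p pn <-]; last by exists p => //; rewrite -ltnS.
  by exists (Ordinal (pn : (p < n.+1)%N)); rewrite //= inE.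
rewrite (@face_number_simplex R d n.+1) //; last exact: (@row_generic_lifted R n d).
by rewrite -sum1dep_card [LHS]big_mkcond; apply: eq_bigr => I _; case: andP.
Qed.

Lemma sum_face_number :
  (\sum_(s : 'S_n) face_number (convex_hull [set psum x s p | p in [set p | (p <= n)%N]]) k
   = 2 * k`! * parity_sum n.+1 k.+1 d)%N.
Proof.
(* Adding the hits to the faces accounts, for each order, for all ['C(n.+1, k.+1)] sets; none of
   them is the full set, as [k.+1 <= d <= n]. *)
apply: (@addnI (count_hits (linear_relation x) k.+1)).
rewrite count_hits_total //; last exact: generic_linear_relation.
rewrite /count_hits -big_split /= -(card_Sn n) -sum_nat_const; apply: eq_bigr => s _.
rewrite face_number_exposed -big_split /= -[X in 'C(X, _)](card_ord n.+1).
rewrite -card_draws -sum1dep_card.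
rewrite [RHS]big_mkcond; apply: eq_bigr => I _ /=; case: eqP => // Ik.
rewrite exposed_hit //=; first by case: asboolP.
apply/eqP => IT; move: Ik; rewrite IT cardsT card_ord => -[nk].
by move: (leq_trans kd dn); rewrite nk ltnn.
Qed.
End FaceCount.

Lemma stirling1_stir1 (n m : nat) : (m <= n)%N -> stirling1 n.+1%:Z m%:Z = stir1 n.+1 m.
Proof.
rewrite /stirling1 => mn; case: m mn => [|m] mn.
  by rewrite (_ : (1 <= 0%:Z <= n.+1%:Z) = false).
by rewrite !lez_nat /= ltnS (ltnW mn) card_perm_cycles.
Qed.

Lemma stirling2_stir2 (n m : nat) : stirling2 n%:Z m.+1%:Z = stir2 n m.+1.
Proof.
rewrite /stirling2 !lez_nat /=; case: ifP => [mn|/negbT]; last first.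
  by rewrite -ltnNge => ?; rewrite stir2_gt.
have := card_partitions [set: 'I_n]%SET m.+1; rewrite cardsT card_ord => <-.
by apply: eq_card => Q; rewrite !inE.
Qed.

Lemma stirling2_neg (n : int) m : n < 0 -> stirling2 n m = 0%N.
Proof.
rewrite /stirling2 => n0; case: ifP => // /andP[h1 h2].
by have := le_lt_trans (le_trans h1 h2) n0.
Qed.

(** The term [l] corresponds to [j = d - 2 * l]. The induction lowers [d] by 2, so the cases 0 and 1
    are the base, where all later arguments are negative. *)
Lemma parity_sum_series (n d k N : nat) : (d <= n)%N -> (d < N)%N ->
  parity_sum n.+1 k.+1 d =
  (\sum_(l < N) stirling1 n.+1%:Z (d%:Z - 2 * l%:Z) * stirling2 (d%:Z - 2 * l%:Z) k.+1%:Z)%N.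
Proof.
have [m] := ubnP d; elim: m => // m IH in d N *; rewrite ltnS => dm dn dN.
case: N dN => // N; rewrite ltnS => dN; rewrite big_ord_recl mulr0 subr0.
rewrite stirling1_stir1 // stirling2_stir2.
have shift (l : 'I_N) : d%:Z - 2 * (lift ord0 l)%:Z = (d%:Z - 2) - 2 * l%:Z.
  by rewrite /= /bump leq0n; lia.
under eq_bigr => l _ do rewrite shift.
case: d {shift} dm dn dN => [|[|d]] dm dn dN.
- rewrite big1 => [|l _]; last by rewrite stirling2_neg ?muln0 //; lia.
  by rewrite parity_sum00 muln0.
- rewrite big1 => [|l _]; last by rewrite stirling2_neg ?muln0 //; lia.
  by rewrite /parity_sum big_mkcond !big_ord_recl big_ord0 /= !addn0.
- have e : d.+2%:Z - 2 = d%:Z by lia.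
  rewrite e -IH; [|lia..].
  rewrite /parity_sum [in LHS]big_mkcond 2!big_ord_recr /= eqxx negbK.
  rewrite (_ : (~~ odd d == odd d) = false); last by case: (odd d).
  by rewrite addn0 addnC -big_mkcond.
Qed.

(** * Measurability and exchangeability *)

Section RationalWitness.
Variables (R : realType) (m N : nat) (Q : 'M[R]_(m, N)) (e : 'I_N -> 'I_m) (I : {set 'I_m}).

(** The vector taking the values [b] on the chosen rows is the adjugate applied to [b], divided by
    the determinant. Multiplying by the determinant squared keeps the signs and leaves a polynomial
    in the entries of [Q]. *)
Definition witness_value (b : {ffun 'I_N -> rat}) (p : 'I_m) : R :=
  \det (rowsub e Q) * (Q *m (\adj (rowsub e Q) *m \col_j ratr (b j))) p 0.

(** A functional is determined by its values on the chosen rows. On the rows in [I] these must be 0,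
    which is rational; the others can be moved to nearby rationals because the remaining conditions
    are strict. This reduces exposure to a countable union. *)
Lemma rational_witness : rowsub e Q \in unitmx -> (forall p, p \in I -> exists j, e j = p) ->
  (exists v : 'cV[R]_N, forall p, (p \in I -> (Q *m v) p 0 = 0) /\
                                (p \notin I -> 0 < (Q *m v) p 0)) <->
  (exists b : {ffun 'I_N -> rat}, [forall j, (e j \in I) ==> (b j == 0)] /\
     forall p, p \notin I -> 0 < witness_value b p).
Proof.
move=> uQ eI; set QJ := rowsub e Q in uQ *; set D := \det QJ.
have rowQ (v : 'cV[R]_N) j : (Q *m v) (e j) 0 = (QJ *m v) j 0.
  by rewrite !mxE; apply: eq_bigr => l _; rewrite !mxE.
have D0 : D != 0 by rewrite -unitfE -unitmxE.
split=> [[v vP]|[b [/forallP bI bP]]]; last first.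
  exists (D *: (\adj QJ *m \col_j ratr (b j))) => p.
  rewrite -scalemxAr mxE; split=> [pI|/bP//].
  have [j jp] := eI p pI; rewrite -jp rowQ mulmxA mul_mx_adj mul_scalar_mx !mxE.
  by have := bI j; rewrite jp pI /= => /eqP ->; rewrite rmorph0 !mulr0.
pose a := QJ *m v.
pose B p := \sum_j `|D * (Q *m \adj QJ) p j|.
have [|eps eps0 epsP] := @perturbation R _ (fun p => p \notin I)
    (fun p => D ^+ 2 * (Q *m v) p 0) B.
  by move=> p /(vP p).2 h; rewrite mulr_gt0 // exprn_even_gt0.
have /choice[q qP] : forall j, exists q : rat, `|ratr q - a j 0| < eps /\ (e j \in I -> q = 0).
  move=> j; have [jI|jI] := boolP (e j \in I).
    by exists 0; rewrite rmorph0 sub0r normrN /a -rowQ (vP _).1 // normr0.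
  have : a j 0 - eps < a j 0 + eps by rewrite ltrD2l gt0_cp.
  case/rat_in_itvoo => q; rewrite in_itv /= => /andP[h1 h2]; exists q; split=> //.
  by rewrite ltr_norml; apply/andP; split; lra.
exists [ffun j => q j]; split.
  by apply/forallP => j; apply/implyP => jI; rewrite ffunE (qP j).2.
move=> p pI; rewrite /witness_value -/QJ -/D.
pose dl : 'cV[R]_N := \col_j (ratr (q j) - a j 0).
have -> : \col_j ratr ([ffun j => q j] j) = a + dl.
  by apply/colP => j; rewrite !mxE ffunE addrC subrK.
have -> : (Q *m (\adj QJ *m (a + dl))) p 0 = D * (Q *m v) p 0 + (Q *m \adj QJ *m dl) p 0.
  rewrite mulmxDr mulmxDr mxE; congr (_ + _); last by rewrite mulmxA.
  by rewrite /a [\adj QJ *m _]mulmxA mul_adj_mx mul_scalar_mx -scalemxAr mxE.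
have [_ h] := epsP p pI; rewrite mulrDr mulrA -expr2.
suff : `|D * (Q *m \adj QJ *m dl) p 0| <= eps * B p by rewrite ler_norml => /andP[h1 h2]; lra.
rewrite mxE mulr_sumr (le_trans (ler_norm_sum _ _ _)) // mulr_sumr ler_sum // => j _.
by rewrite mulrA normrM mulrC ler_wpM2r // mxE ltW // (qP j).1.
Qed.
End RationalWitness.

Section MeasurableMatrix.
Context {dX : measure_display} {X : measurableType dX} {R : realType}.

Definition measurable_mx a b (M : X -> 'M[R]_(a, b)) : Prop :=
  forall i j, measurable_fun setT (fun t => M t i j).

Lemma measurable_det a (M : X -> 'M[R]_a) : measurable_mx M ->
  measurable_fun setT (fun t => \det (M t)).
Proof.
move=> mM; apply: measurable_sum => s; apply: measurable_funM; first exact: measurable_cst.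
by apply: measurable_prod => i _; exact: mM.
Qed.

Lemma measurable_mulmx a b c (M : X -> 'M[R]_(a, b)) (M' : X -> 'M[R]_(b, c)) :
  measurable_mx M -> measurable_mx M' -> measurable_mx (fun t => M t *m M' t).
Proof.
move=> mM mM' i j; under eq_fun do rewrite mxE.
by apply: measurable_sum => l; apply: measurable_funM; [exact: mM|exact: mM'].
Qed.

Lemma measurable_adj a (M : X -> 'M[R]_a) : measurable_mx M ->
  measurable_mx (fun t => \adj (M t)).
Proof.
move=> mM i j; under eq_fun do rewrite mxE.
apply: measurable_funM; first exact: measurable_cst.
apply: measurable_det => p q; under eq_fun do rewrite !mxE; exact: mM.
Qed.

Lemma measurable_witness_value m N (Q : X -> 'M[R]_(m, N)) e b p : measurable_mx Q ->
  measurable_fun setT (fun t => witness_value (Q t) e b p).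
Proof.
move=> mQ; have mJ : measurable_mx (fun t => rowsub e (Q t)).
  by move=> i j; under eq_fun do rewrite mxE; exact: mQ.
apply: measurable_funM; first exact: measurable_det.
apply: (measurable_mulmx mQ); apply: measurable_mulmx; first exact: measurable_adj.
by move=> i j; exact: measurable_cst.
Qed.
End MeasurableMatrix.

Section AeIntegral.
Local Open Scope ereal_scope.
Context {dX : measure_display} {X : measurableType dX} {R : realType}.
Variable mu : {measure set X -> \bar R}.

Import HBNNSimple.

(** The integral of a nonnegative function is a supremum over the simple functions below it, hence
    monotone without measurability. *)
Lemma le_integral_nonmeasurable (f g : X -> \bar R) :
  (forall x, 0 <= f x) -> (forall x, f x <= g x) -> \int[mu]_x f x <= \int[mu]_x g x.
Proof.
move=> f0 fg; have g0 x : 0 <= g x by apply: le_trans (fg x).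
rewrite !ge0_integralTE //; apply: le_ereal_sup => _ [h hf <-]; exists h => //.
by move=> x; apply: le_trans (fg x).
Qed.

(* [face_number] is not known to be measurable on the null set where general
   position fails; [f] is squeezed between [g] set to 0 and [g] set to [+oo] on
   a null set. *)
Lemma ae_integral_nonmeasurable (f g : X -> \bar R) :
  (forall x, 0 <= f x) -> (forall x, 0 <= g x) -> measurable_fun setT g ->
  {ae mu, forall x, f x = g x} -> \int[mu]_x f x = \int[mu]_x g x.
Proof.
move=> f0 g0 mg [N [mN N0 fgN]].
have fg x : ~ N x -> f x = g x by move=> nN; apply: contrapT => h; apply: nN; exact: fgN.
have aeN (h1 h2 : X -> \bar R) : (forall x, ~ N x -> h1 x = h2 x) -> ae_eq mu setT h1 h2.
  move=> h; exists N; split => // x /= hx; apply: contrapT => nN; apply: hx => _; exact: h.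
have m2 (a : \bar R) : measurable_fun setT (fun x => if x \in N then a else g x).
  apply: measurable_fun_ifT => //; apply: (measurable_fun_bool true).
  rewrite setTI (_ : _ @^-1` _ = N) //.
  by apply/seteqP; split=> x /= => [/set_mem|/mem_set].
have E a : 0 <= a -> \int[mu]_x (if x \in N then a else g x) = \int[mu]_x g x.
  move=> a0; apply: ge0_ae_eq_integral => //; first by move=> x _; case: ifP.
  by apply: aeN => x nN; rewrite memNset.
apply/eqP; rewrite eq_le -{1}(E +oo) ?leey // -{1}(E 0) //; apply/andP; split.
  apply: le_integral_nonmeasurable => // x; case: ifPn => xN; first exact: leey.
  by rewrite fg //; move: xN; rewrite notin_setE.
apply: le_integral_nonmeasurable => x; case: ifPn => // xN.
by rewrite fg //; move: xN; rewrite notin_setE.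
Qed.
End AeIntegral.

Lemma ltn_enum_val n (A : {set 'I_n}) (i j : 'I_#|A|) :
  (i < j)%N -> (enum_val i < enum_val j)%N.
Proof.
have tr : transitive (fun a b : 'I_n => (a < b)%N) by move=> a b c; exact: ltn_trans.
have st : sorted (fun a b : 'I_n => (a < b)%N) (enum A).
  rewrite {1}/enum_mem; apply: sorted_filter => //; rewrite -enumT.
  have := iota_ltn_sorted 0 n; rewrite -val_enum_ord.
  by rewrite sorted_map.
rewrite /enum_val => ij; set x0 := enum_default i; rewrite (set_nth_default x0 (enum_default j)).
  by apply: (sorted_ltn_nth tr x0 st) => //; rewrite inE -cardE.
by rewrite -cardE.
Qed.

Section Permuted.
Variables (R : realType) (n d : nat).
Implicit Types (x : 'I_n -> 'rV[R]_d) (s : 'S_n).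

Lemma psum_perm x s s' p : psum (fun i => x (s i)) s' p = psum x (s' * s)%g p.
Proof. by apply: eq_bigr => q _; rewrite permM. Qed.

Lemma in_general_position_perm x s :
  in_general_position x -> in_general_position (fun i => x (s i)).
Proof.
move=> gx s' D Dd l lD; under eq_bigr do rewrite psum_perm.
exact: (gx _ D).
Qed.

Lemma exposed_perm x s I : exposed (fun i => x (s i)) 1%g I <-> exposed x s I.
Proof.
by rewrite /exposed; split=> -[u [c uc]]; exists u, c => p; have := uc p;
  rewrite psum_perm mul1g.
Qed.

Definition det_position x : Prop :=
  forall s (i : {ffun 'I_d -> 'I_n}), (forall j1 j2 : 'I_d, (j1 < j2)%N -> (i j1 < i j2)%N) ->
    \det (\matrix_j psum x s (i j).+1) != 0.

Lemma det_general_position x : det_position x -> in_general_position x.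
Proof.
move=> dx s D Dd l lD sl.
pose i : {ffun 'I_d -> 'I_n} := [ffun j => enum_val (cast_ord (esym Dd) j)].
have M0 : \det (\matrix_j psum x s (i j).+1) != 0.
  by apply: dx => j1 j2 j12; rewrite !ffunE; exact: ltn_enum_val.
have v0 : (\row_j l (i j)) *m (\matrix_j psum x s (i j).+1) = 0.
  rewrite mulmx_sum_row -[RHS]sl (bigID [in D]) /= [X in _ = _ + X]big1 ?addr0; last first.
    by move=> p pD; rewrite lD // scale0r.
  rewrite [RHS]big_enum_val [RHS](reindex (cast_ord (esym Dd))) /=; last first.
    by exists (cast_ord Dd) => j _; rewrite ?cast_ordK ?cast_ordKV.
  by apply: eq_bigr => j _; rewrite mxE rowK ffunE.
have {}v0 : \row_j l (i j) = 0 :> 'rV[R]_d.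
  rewrite -[LHS](mulmxK (_ : \matrix_j psum x s (i j).+1 \in unitmx)) ?v0 ?mul0mx //.
  by rewrite unitmxE unitfE.
move=> p; have [pD|/lD//] := boolP (p \in D).
have := congr1 (fun v : 'rV_d => v 0 (cast_ord Dd (enum_rank_in pD p))) v0.
by rewrite !mxE ffunE cast_ordK enum_rankK_in.
Qed.
End Permuted.

Lemma row_free_cast (F : fieldType) a b N (A : 'M[F]_(a, N)) (h : b = a) :
  row_free (rowsub (cast_ord h) A) = row_free A.
Proof.
subst a; congr row_free; apply/matrixP => i j.
by rewrite mxE cast_ord_id.
Qed.

Section MeasurableExposed.
Variables (R : realType) (n d : nat).
Hypothesis dn : (d <= n)%N.

Definition increments (t : n.-tuple (d.-tuple R)) (i : 'I_n) : 'rV[R]_d := row_of (tnth t i).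

Lemma measurable_psum s p j :
  measurable_fun setT (fun t : n.-tuple (d.-tuple R) => psum (increments t) s p 0 j).
Proof.
rewrite (_ : (fun t => _) =
    fun t => \sum_(q < n) if (q < p)%N then tnth (tnth t (s q)) j else 0); last first.
  apply: funext => t; rewrite summxE big_mkcond; apply: eq_bigr => q _.
  by case: ifP => // _; rewrite mxE.
apply: measurable_sum => q; case: (q < p)%N; last exact: measurable_cst.
apply: (measurableT_comp (measurable_tnth j)); exact: measurable_tnth.
Qed.

Lemma measurable_lifted s :
  measurable_mx (fun t : n.-tuple (d.-tuple R) => lifted (increments t) s).
Proof.
move=> p j; under eq_fun do rewrite !mxE.
case: splitP => l _; first exact: measurable_psum.
exact: measurable_cst.
Qed.

(** Extend [I] to [d.+1] points. In general position their lifted rows are invertible, and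
    [rational_witness] describes exposure by countably many polynomial inequalities; that
    description is measurable everywhere, including where it need not mean exposure. *)
Lemma exposed_measurable (I : {set 'I_n.+1}) : (#|I| <= d.+1)%N ->
  exists2 E : set (n.-tuple (d.-tuple R)), measurable E &
    forall t, in_general_position (increments t) -> (E t <-> exposed (increments t) 1%g I).
Proof.
move=> Id.
have [J IJ Jd] : exists2 J : {set 'I_n.+1}, I \subset J & #|J| = (d + 1)%N.
  have : (d.+1 - #|I| <= #|~: I|%SET)%N by rewrite leq_subLR cardsC card_ord.
  case/card_geqP => sq [us sz sub]; exists (I :|: [set p in sq])%SET.
    exact: finset.subsetUl.
  rewrite cardsU (_ : #|[set p in sq]|%SET = d.+1 - #|I|)%N; last first.
    by rewrite cardsE -sz; exact/card_uniqP.
  have -> : (I :&: [set p in sq])%SET = finset.set0.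
    by apply/setP => p; rewrite !inE; apply/andP => -[pI /sub]; rewrite !inE pI.
  by rewrite cards0 subn0 subnKC // addn1.
pose e (j : 'I_(d + 1)) : 'I_n.+1 := enum_val (cast_ord (esym Jd) j).
have eI p : p \in I -> exists j, e j = p.
  move=> /(fintype.subsetP IJ) pJ; exists (cast_ord Jd (enum_rank_in pJ p)).
  by rewrite /e cast_ordK enum_rankK_in.
have eU t : in_general_position (increments t) ->
    rowsub e (lifted (increments t) 1%g) \in unitmx.
  move=> gt; rewrite -row_free_unit.
  have fJ := select_free (row_generic_lifted dn (s := 1%g) gt) (eq_leq Jd).
  rewrite -(row_free_cast _ (esym Jd)) in fJ; move: fJ; congr row_free.
  apply/row_matrixP => j; rewrite !row_rowsub; exact: row_select.
pose ok (b : {ffun 'I_(d + 1) -> rat}) := [forall j, (e j \in I) ==> (b j == 0)].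
exists (\bigcup_b [set t | ok b /\
    forall p, p \notin I -> 0 < witness_value (lifted (increments t) 1%g) e b p]); last first.
  move=> t gt; rewrite exposedP (rational_witness (eU t gt) eI).
  by split=> [[b _ /= [h1 h2]]|[b [h1 h2]]]; exists b.
apply: countable_bigcupT_measurable; first exact: countableP.
move=> b; case: (boolP (ok b)) => okb; last first.
  by rewrite (_ : [set t | _] = set0) //; apply/seteqP; split=> t // -[].
rewrite (_ : [set t | _] = \bigcap_(p in [set p | p \notin I])
  [set t | 0 < witness_value (lifted (increments t) 1%g) e b p]); last first.
  by apply/seteqP; split=> [t [_ h] p /h|t h] //; split=> // p pI; exact: h.
apply: fin_bigcap_measurable; first exact: finite_finset.
move=> p _.
have := measurable_fun_ltr (measurable_cst (0 : R))
  (measurable_witness_value e b p (measurable_lifted 1%g)).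
move=> /(_ measurableT [set true]); rewrite setTI; exact.
Qed.
End MeasurableExposed.

(** * Almost sure general position in every order *)

Section RandomWalkFaces.
Context {R : realType} {dT : measure_display} {T : measurableType dT}.
Context {P : probability T R} {n d : nat} {xi : 'I_n -> {RV P >-> d.-tuple R}}.
Hypotheses (dn : (d <= n)%N) (Ex : exchangeable xi) (GP : general_position xi).

Let steps (s : 'S_n) (w : T) : n.-tuple (d.-tuple R) := [tuple xi (s i) w | i < n].
Let steps1 (w : T) : n.-tuple (d.-tuple R) := [tuple xi i w | i < n].

Lemma measurable_steps s : measurable_fun setT (steps s).
Proof.
apply/measurable_fun_tnthP => i.
rewrite (_ : _ \o _ = xi (s i)); first exact: measurable_funPT.
by apply: funext => w; rewrite /= tnth_mktuple.
Qed.

Lemma steps_exchangeable s A : measurable A -> P (steps s @^-1` A) = P (steps1 @^-1` A).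
Proof. by move=> mA; exact: (Ex s mA). Qed.

Lemma increments_steps s w : increments (steps s w) = fun i => row_of (xi (s i) w).
Proof. by apply: funext => i; rewrite /increments tnth_mktuple. Qed.

Lemma increments_steps1 w : increments (steps1 w) = fun i => row_of (xi i w).
Proof. by apply: funext => i; rewrite /increments tnth_mktuple. Qed.

Lemma walk_psum p w : walk xi p w = psum (fun i => row_of (xi i w)) 1%g p.
Proof. by apply: eq_bigr => i _; rewrite perm1. Qed.

Lemma free_det (v : 'I_d -> 'rV[R]_d) :
  free [tuple v j | j < d] = (\det (\matrix_j v j) != 0).
Proof.
rewrite -unitfE -unitmxE -row_free_unit -kermx_eq0; apply/freeP/eqP => [h|h k k0 i].
  apply/row_matrixP => r; have := congr1 (row r) (mulmx_ker (\matrix_j v j)).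
  rewrite row_mul !row0 mulmx_sum_row => e; apply/rowP => j; rewrite [RHS]mxE.
  apply: (h (fun i => row r (kermx (\matrix_j v j)) 0 i)); rewrite -[RHS]e.
  by apply: eq_bigr => l _; rewrite -tnth_nth tnth_mktuple rowK.
have : (\row_i k i <= kermx (\matrix_j v j))%MS.
  apply/sub_kermxP; rewrite mulmx_sum_row -[RHS]k0.
  by apply: eq_bigr => l _; rewrite -tnth_nth tnth_mktuple rowK mxE.
by rewrite h submx0 => /eqP/(congr1 (fun w : 'rV_d => w 0 i)); rewrite !mxE.
Qed.

(** A vanishing determinant in order [s] is the event that the permuted tuple of steps falls into a
    measurable set; exchangeability replaces [s] by the given order, where the hypothesis
    applies. *)
Lemma det_null s (i : {ffun 'I_d -> 'I_n}) :
  (forall j1 j2 : 'I_d, (j1 < j2)%N -> (i j1 < i j2)%N) ->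
  {ae P, forall w, \det (\matrix_j psum (fun i => row_of (xi i w)) s (i j).+1) != 0}.
Proof.
move=> ii; pose D t := \det (\matrix_j psum (@increments R n d t) 1%g (i j).+1).
have mD : measurable_fun setT D.
  apply: measurable_det => j l; under eq_fun do rewrite mxE.
  exact: measurable_psum.
have mA : measurable (D @^-1` [set 0]) by rewrite -[_ @^-1` _]setTI; apply: mD.
exists (steps s @^-1` (D @^-1` [set 0])); split.
- by rewrite -[_ @^-1` _]setTI; apply: measurable_steps.
- rewrite steps_exchangeable //.
  have <- : P [set w | ~~ free [tuple walk xi (i j).+1 w | j < d]] = 0%E.
    by apply: (GP (i := fun j => (i j).+1)) => // j; rewrite ltn_ord.
  have E w : (~~ free [tuple walk xi (i j).+1 w | j < d]) = (D (steps1 w) == 0).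
    rewrite (_ : [tuple _ | _ < d] =
                 [tuple psum (fun i => row_of (xi i w)) 1%g (i j).+1 | j < d]).
      by rewrite free_det negbK /D increments_steps1.
    by apply: eq_from_tnth => j; rewrite !tnth_mktuple walk_psum.
  congr (P _); apply/seteqP; split=> w; rewrite /mkset /preimage.
    by move=> h; rewrite E; apply/eqP.
  by rewrite E => /eqP.
- move=> w /= /negP; rewrite negbK => /eqP <-; rewrite /D increments_steps.
  congr (\det _); apply/matrixP => j l; rewrite !mxE.
  by rewrite (psum_perm (fun i => row_of (xi i w))) mul1g.
Qed.

Lemma ae_general_position :
  {ae P, forall w, in_general_position (fun i => row_of (xi i w))}.
Proof.
suff : {ae P, forall w, forall s (i : {ffun 'I_d -> 'I_n}),
    (forall j1 j2 : 'I_d, (j1 < j2)%N -> (i j1 < i j2)%N) ->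
    \det (\matrix_j psum (fun i => row_of (xi i w)) s (i j).+1) != 0}.
  by apply: filterS => w; exact: det_general_position.
apply: filter_forall => s; apply: filter_forall => i.
have [ii|nii] := pselect (forall j1 j2 : 'I_d, (j1 < j2)%N -> (i j1 < i j2)%N).
  by apply: filterS (det_null s ii) => w.
by apply: nearW => w /nii.
Qed.
End RandomWalkFaces.

(** * The expected face number *)

Section ExpectedFaceNumber.
Context {R : realType} {dT : measure_display} {T : measurableType dT}.
Context {P : probability T R} {n d : nat} {xi : 'I_n -> {RV P >-> d.-tuple R}}.
Hypotheses (dn : (d <= n)%N) (Ex : exchangeable xi) (GP : general_position xi).
Variables (k : nat) (kd : (k < d)%N).

Let steps (s : 'S_n) (w : T) : n.-tuple (d.-tuple R) := [tuple xi (s i) w | i < n].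
Let steps1 (w : T) : n.-tuple (d.-tuple R) := [tuple xi i w | i < n].

Section Counting.
Variables (D : finType) (f : pred D) (B : D -> set T).
Hypothesis mB : forall i, measurable (B i).

Let countE w : (((\sum_(i | f i) (w \in B i : nat))%N%:R : R)%:E =
  \sum_(i <- [seq i <- index_enum D | f i]) (\1_(B i) w)%:E)%E.
Proof.
rewrite natr_sum -sumEFin big_filter; apply: eq_bigr => i _.
by rewrite indicE.
Qed.

Let mindic i : measurable_fun setT (fun w => (\1_(B i) w : R)%:E).
Proof. by apply/measurable_EFinP; exact: measurable_indic. Qed.

Lemma measurable_count :
  measurable_fun setT (fun w => ((\sum_(i | f i) (w \in B i : nat))%N%:R : R)%:E).
Proof. by under eq_fun do rewrite countE; exact: emeasurable_sum. Qed.

Lemma integral_count :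
  (\int[P]_w (((\sum_(i | f i) (w \in B i : nat))%N%:R : R)%:E) = \sum_(i | f i) P (B i))%E.
Proof.
under eq_integral => w _ do rewrite countE.
rewrite (ge0_integral_sum P measurableT mindic) => [|i w _]; last first.
  by rewrite lee_fin indicE ler0n.
by rewrite big_filter; apply: eq_bigr => i _; rewrite integral_indic // setIT.
Qed.
End Counting.

Lemma walk_hull_psum w : walk_hull xi w =
  convex_hull [set psum (fun i => row_of (xi i w)) 1%g p | p in [set p | (p <= n)%N]].
Proof. by congr convex_hull; apply: eq_imagel => p _; exact: walk_psum. Qed.

Lemma expected_face_number :
  (\int[P]_w (((face_number (walk_hull xi w) k)%:R : R)%:E) =
   (((2 * k`! * parity_sum n.+1 k.+1 d)%:R / n`!%:R : R))%:E)%E.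
Proof.
have [E mE EP] : exists2 E : {set 'I_n.+1} -> set (n.-tuple (d.-tuple R)),
    forall I : {set 'I_n.+1}, measurable (E I) &
    forall I : {set 'I_n.+1}, #|I| = k.+1 -> forall t : n.-tuple (d.-tuple R),
      in_general_position (increments t) -> (E I t <-> exposed (increments t) 1%g I).
  have /choice[E EP] : forall I : {set 'I_n.+1}, exists E : set (n.-tuple (d.-tuple R)),
      measurable E /\ (#|I| = k.+1 -> forall t : n.-tuple (d.-tuple R),
      in_general_position (increments t) -> (E t <-> exposed (increments t) 1%g I)).
    move=> I; have [Ik|Ik] := eqVneq #|I| k.+1.
      have [|E mE EP] := @exposed_measurable R n d dn I; first by rewrite Ik ltnW.
      by exists E.
    by exists set0; split => // e; rewrite e eqxx in Ik.
  by exists E => I; have [] := EP I.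
have ms s I : measurable (steps s @^-1` E I).
  by rewrite -[_ @^-1` _]setTI; apply: measurable_steps.
have steps1E : steps1 = steps 1%g.
  by apply: funext => w; apply: eq_from_tnth => i; rewrite !tnth_mktuple perm1.
have ms1 I : measurable (steps1 @^-1` E I) by rewrite steps1E.
have aeG := ae_general_position Ex GP.
pose S : \bar R := (\sum_(I : {set 'I_n.+1} | #|I| == k.+1) P (steps1 @^-1` E I))%E.
have face_steps w s : in_general_position (fun i => row_of (xi i w)) ->
    (\sum_(I : {set 'I_n.+1} | #|I| == k.+1) (w \in steps s @^-1` E I : nat))%N =
    face_number (convex_hull [set psum (fun i => row_of (xi i w)) s p |
                                p in [set p | (p <= n)%N]]) k.
  move=> gw; rewrite face_number_exposed // [LHS]big_mkcond; apply: eq_bigr => I _.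
  case: eqP => //= Ik; congr nat_of_bool.
  have gs := in_general_position_perm (s := s) gw; rewrite -(increments_steps s w) in gs.
  have := EP I Ik _ gs; rewrite increments_steps (exposed_perm (fun i => row_of (xi i w))) => e.
  by apply/idP/asboolP => [/set_mem/e|/e/mem_set].
have HF : (\int[P]_w (((face_number (walk_hull xi w) k)%:R : R)%:E) = S)%E.
  rewrite /S -(integral_count (fun I : {set 'I_n.+1} => #|I| == k.+1) ms1).
  apply: ae_integral_nonmeasurable => [w|w||].
  - by rewrite lee_fin ler0n.
  - by rewrite lee_fin ler0n.
  - exact: measurable_count.
  - apply: filterS aeG => w gw; congr (_%:R%:E); rewrite walk_hull_psum -face_steps //.
    by rewrite steps1E.
(* Exchangeability gives each of the [n!] copies of [S] its own order [s]; gathered under one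
   integral, they sum to a count that is almost surely the constant of [sum_face_number]. *)
have HS : (\sum_(s : 'S_n) S = (2 * k`! * parity_sum n.+1 k.+1 d)%:R%:E)%E.
  under eq_bigr => s _ do rewrite /S.
  under eq_bigr => s _ do under eq_bigr => I _ do rewrite -(steps_exchangeable Ex s (mE I)).
  rewrite pair_big_dep /=.
  rewrite -(integral_count (fun sI : 'S_n * {set 'I_n.+1} => #|sI.2| == k.+1)
    (fun sI => ms sI.1 sI.2)).
  transitivity (\int[P]_w ((2 * k`! * parity_sum n.+1 k.+1 d)%:R : R)%:E)%E; last first.
    by rewrite -[RHS](expectation_cst P) unlock.
  apply: ae_integral_nonmeasurable => [w|w||].
  - by rewrite lee_fin ler0n.
  - by rewrite lee_fin ler0n.
  - exact: measurable_cst.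
  - apply: filterS aeG => w gw; congr (_%:R%:E).
    rewrite -(sum_face_number dn gw kd) -(pair_big_dep xpredT
      (fun _ (I : {set 'I_n.+1}) => #|I| == k.+1)
      (fun s (I : {set 'I_n.+1}) => (w \in steps s @^-1` E I : nat))) /=.
    by apply: eq_bigr => s _; exact: face_steps.
(* Finiteness allows the factor [n!] to be cancelled in [R]. *)
have Sfin : S \is a fin_num.
  by apply/sum_fin_numP => I _ _; exact: fin_num_measure.
move: HS; rewrite HF -(fineK Sfin) sumEFin sumr_const card_Sn => -[<-].
by rewrite -[fine S *+ _]mulr_natr mulfK // pnatr_eq0 -lt0n fact_gt0.
Qed.
End ExpectedFaceNumber.

Theorem theorem1p2 (R : realType) (dT : measure_display) (T : measurableType dT)
    (P : probability T R) (n d : nat) (hd : (1 <= d)%N) (hdn : (d <= n)%N)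
    (xi : 'I_n -> {RV P >-> d.-tuple R})
    (Ex : exchangeable xi) (GP : general_position xi)
    (k : nat) (hk : (k <= d - 1)%N) :
  ('E_P[fun w => ((face_number (walk_hull xi w) k)%:R : R)%R] =
   (2 * k`!%:R / n`!%:R)%R%:E *
   \sum_(0 <= l <oo)
     ((stirling1 n.+1%:Z (d%:Z - 2 * l%:Z)%R *
       stirling2 (d%:Z - 2 * l%:Z)%R k.+1%:Z)%N%:R)%R%:E)%E.
Proof.
have kd : (k < d)%N by lia.
rewrite unlock (expected_face_number hdn Ex GP kd).
rewrite (@nneseries_split _ _ 0 d.+1) => [|l _]; last by rewrite lee_fin ler0n.
(* For [l > d] the argument [d - 2 * l] is negative, so cutting the series at [d.+1] loses
   nothing. *)
rewrite eseries0 => [|l dl _]; last by rewrite stirling2_neg ?muln0 //; lia.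
rewrite adde0 add0n big_mkord sumEFin -natr_sum -EFinM.
rewrite -(@parity_sum_series n d k d.+1) // !natrM.
by congr (_%:E); rewrite mulrAC.
Qed.
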